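(* Let $(X,\mathfrak M,\mu)$ be a finite measure space with a filtration $\{\mathfrak B_n\}_{n\ge0}$ whose ball-basis $\mathfrak B=\bigcup_{n\ge0}\mathfrak B_n$ is doubling, and let $1<r<\infty$. Let $\varepsilon=\{\varepsilon_A\}_{A\in\mathfrak B}$ be real numbers with $|\varepsilon_A|\le1$, and let $T$ be any one of the operators $$M_\varepsilon f=\sum_{A\in\mathfrak B}\varepsilon_A\Delta_Af,\qquad M_{\varepsilon,n}f=\sum_{A\in\bigcup_{0\le k\le n}\mathfrak B_k}\varepsilon_A\Delta_Af,$$ $$M^*_\varepsilon f=\sup_n|M_{\varepsilon,n}f|,\quad M^+_\varepsilon f=\sup_nM_{\varepsilon,n}f,\quad M^-_\varepsilon f=\inf_nM_{\varepsilon,n}f,\quad Sf=\Big(\sum_{A\in\mathfrak B}|\Delta_Af|^2\Big)^{1/2}.$$ Then there is a constant $C$ depending only on the ball-basis and $r$ such that $$\mathrm{OSC}_{B,\beta}(T(f))\le C\left((1-\beta)^{-1/r}\|T\|_{L^r(X)\to L^{r,\infty}(X)}+\mathcal L_\omega(T)\right)\langle f\rangle^*_{\#,B}$$ for all $f\in L^r(X)$, $B\in\mathfrak B$ and $0<\beta<1$, where $\omega(t)=1/\log_2(1+t)$. Moreover, $T$ is bounded on $\mathrm{BMO}(X)$: there is a constant $C'$ with $\|T(f)\|_{\mathrm{BMO}(X)}\le C'\|f\|_{\mathrm{BMO}(X)}$ for all $f\in\mathrm{BMO}(X)$.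
   Context: **Filtration.** $\mathfrak B_0=\{X\}$; each $\mathfrak B_n$ is a finite or countable partition of $X$ into measurable sets (of positive finite measure); each $A\in\mathfrak B_n$ is a union of sets of $\mathfrak B_{n+1}$; $\mathfrak B=\bigcup_n\mathfrak B_n$ generates the $\sigma$-algebra $\mathfrak M$. For $A\in\mathfrak B_n$, $n\ge1$, $\mathrm{pr}(A)$ is the unique element of $\mathfrak B_{n-1}$ containing $A$. The elements of $\mathfrak B$ are called balls. The hull-ball $A^*$ of $A$ is the maximal element of $\mathfrak B$ with $A^*\supset A$ and $\mu(A^* )\le2\mu(A)$. Doubling: there is $\eta>2$ such that for every ball $B$ with $B^*\ne X$ there is a ball $B'\supset B$ with $2\mu(B)\le\mu(B')\le\eta\mu(B)$. **Martingale differences.** For $f\in L^1(X)$ and $A\in\mathfrak B$, $$\Delta_Af(x)=\sum_{B:\,\mathrm{pr}(B)=A}\Big(\frac1{\mu(B)}\int_Bf-\frac1{\mu(A)}\int_Af\Big)\mathbf1_B(x).$$ **Notation.** $f_B=\frac1{\mu(B)}\int_Bf$, $\langle f\rangle_B=\big(\frac1{\mu(B)}\int_B|f|^r\big)^{1/r}$, $\langle f\rangle_{\#,B}=\langle f-f_B\rangle_B$, $\langle f\rangle^*_{\#,B}=\sup_{A\in\mathfrak B,A\supset B}\langle f\rangle_{\#,A}$, $\|f\|_{\mathrm{BMO}}=\sup_{B\in\mathfrak B}\langle f\rangle_{\#,B}$. $\mathrm{OSC}_E(F)=\operatorname{ess\,sup}_{x,x'\in E}|F(x)-F(x')|$; $\mathrm{OSC}_{B,\beta}(F)=\inf\{\mathrm{OSC}_E(F):E\subset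 B\text{ measurable},\ \mu(E)>\beta\mu(B)\}$. $\mathcal L_\omega(T)$ is the least $L$ with $\mathrm{OSC}_B(T(f\cdot\mathbf1_{X\setminus B^*}))\le L\sup_{A\in\mathfrak B,A\supset B}\big(\omega(\mu(A)/\mu(B))\langle f\rangle_A\big)$ for all $f\in L^r(X)$ and all balls $B$. $\|T\|_{L^r\to L^{r,\infty}}$ is the weak-type $(r,r)$ norm. *)

(* Defs.v *)
From HB Require Import structures.
From mathcomp Require Import all_boot all_order all_algebra.
From mathcomp Require Import all_classical all_reals all_analysis.
From mathcomp Require Import ess_sup_inf hoelder.

Set Implicit Arguments.
Unset Strict Implicit.
Unset Printing Implicit Defensive.
Import Order.TTheory GRing.Theory Num.Theory.
Import numFieldNormedType.Exports.

Local Open Scope classical_set_scope.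
Local Open Scope ring_scope.

Definition balls (X : Type) (BB : nat -> set (set X)) : set (set X) :=
  \bigcup_n BB n.

Record filtration d (X : measurableType d) (R : realType)
    (mu : {finite_measure set X -> \bar R}) (BB : nat -> set (set X)) : Prop := {
  filt0 : BB 0%N = [set [set: X]];
  filt_countable : forall n, countable (BB n);
  filt_partition : forall n, partition (BB n) id [set: X];
  filt_measurable : forall n A, BB n A -> measurable A;
  filt_mu_gt0 : forall n A, BB n A -> (0 < mu A)%E;
  filt_refine : forall n A, BB n A ->
    exists2 S : set (set X), S `<=` BB n.+1 & A = \bigcup_(B in S) B;
  filt_generate : @measurable d X = <<s balls BB >>
}.

(* A set may belong to several of the partitions; [is_parent] then relates it
   both to itself and to its strict parent, and the reflexive pairs contribute
   0 to [mdiff]. *)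
Definition is_parent (X : Type) (BB : nat -> set (set X)) (B A : set X) : Prop :=
  exists n, [/\ BB n.+1 B, BB n A & B `<=` A].

Section ball_basis.
Context d (X : measurableType d) (R : realType).
Variable mu : {finite_measure set X -> \bar R}.
Variable BB : nat -> set (set X).

Definition is_hull (A A' : set X) : Prop :=
  let P A1 := [/\ balls BB A1, A `<=` A1 & (mu A1 <= 2%:E * mu A)%E] in
  P A' /\ forall A1, P A1 -> A' `<=` A1 -> A1 = A'.

Definition hull (A : set X) : set X := get (is_hull A).

Definition doubling : Prop :=
  exists2 eta : R, 2 < eta & forall B, balls BB B -> hull B <> setT ->
    exists B', [/\ balls BB B', B `<=` B',
      (2%:E * mu B <= mu B')%E & (mu B' <= eta%:E * mu B)%E].

(* F_B; meaningful when F is integrable on B. *)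
Definition avg (F : X -> \bar R) (B : set X) : R :=
  fine (\int[mu]_(x in B) F x)%E / fine (mu B).

Definition mean (r : R) (F : X -> \bar R) (B : set X) : \bar R :=
  (((fine (mu B))^-1%:E * \int[mu]_(x in B) (`|F x| `^ r)) `^ r^-1)%E.

Definition sharp (r : R) (F : X -> \bar R) (B : set X) : \bar R :=
  mean r (fun x => F x - (avg F B)%:E)%E B.

Definition sharp_sup (r : R) (F : X -> \bar R) (B : set X) : \bar R :=
  ereal_sup [set sharp r F A | A in [set A | balls BB A /\ B `<=` A]].

Definition bmo_norm (r : R) (F : X -> \bar R) : \bar R :=
  ereal_sup [set sharp r F B | B in balls BB].

Definition in_bmo (r : R) (F : X -> \bar R) : Prop :=
  mu.-integrable setT F /\ (bmo_norm r F < +oo)%E.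

Definition osc (E : set X) (F : X -> \bar R) : \bar R :=
  ess_sup (mu \x mu)%E
    ((fun p : X * X => `|F p.1 - F p.2|%E) \_ (E `*` E)).

Definition osc_beta (B : set X) (beta : R) (F : X -> \bar R) : \bar R :=
  ereal_inf [set osc E F | E in
    [set E | [/\ E `<=` B, measurable E & (beta%:E * mu B < mu E)%E]]].

(* At each point x at most two indices B have 1_B(x) nonzero, so
   that the finitely supported sum is the full one. *)
Definition mdiff (A : set X) (f : X -> R) (x : X) : R :=
  \sum_(B \in [set B | is_parent BB B A])
    (avg (EFin \o f) B - avg (EFin \o f) A) * \1_B x.

(* Only the finitely many A containing x contribute. *)
Definition mtransn (eps : set X -> R) (n : nat) (f : X -> R) (x : X) : R :=
  \sum_(A \in \bigcup_(k in [set k | (k <= n)%N]) BB k) eps A * mdiff A f x.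

(* The sum over all balls is conditionally convergent in general: it is the
   almost everywhere limit of the sums over the first n levels. *)
Definition mtrans (eps : set X -> R) (f : X -> R) (x : X) : \bar R :=
  limn (fun n => (mtransn eps n f x)%:E).

Definition mtrans_star (eps : set X -> R) (f : X -> R) (x : X) : \bar R :=
  ereal_sup (range (fun n => `|mtransn eps n f x|%:E)).

Definition mtrans_plus (eps : set X -> R) (f : X -> R) (x : X) : \bar R :=
  ereal_sup (range (fun n => (mtransn eps n f x)%:E)).

Definition mtrans_minus (eps : set X -> R) (f : X -> R) (x : X) : \bar R :=
  ereal_inf (range (fun n => (mtransn eps n f x)%:E)).

Definition square_function (f : X -> R) (x : X) : \bar R :=
  ((\esum_(A in balls BB) (`|mdiff A f x| ^+ 2)%:E) `^ 2^-1)%E.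

Inductive martingale_operator (eps : set X -> R) :
    ((X -> R) -> X -> \bar R) -> Prop :=
| op_mtrans : martingale_operator eps (mtrans eps)
| op_mtransn n : martingale_operator eps (fun f x => (mtransn eps n f x)%:E)
| op_mtrans_star : martingale_operator eps (mtrans_star eps)
| op_mtrans_plus : martingale_operator eps (mtrans_plus eps)
| op_mtrans_minus : martingale_operator eps (mtrans_minus eps)
| op_square : martingale_operator eps square_function.

Definition weak_norm (r : R) (F : X -> \bar R) : \bar R :=
  ereal_sup [set (t%:E * mu [set x | t%:E < `|F x|] `^ r^-1)%E |
    t in [set t : R | 0 < t]].

Definition weak_type_norm (r : R) (T : (X -> R) -> X -> \bar R) : \bar R :=
  ereal_inf [set K%:E | K in [set K : R | 0 <= K /\
    forall f : X -> R, f \in Lfun mu r%:E ->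
      (weak_norm r (T f) <= K%:E * 'N[mu]_r%:E [EFin \o f])%E]].

Definition osc_norm (r : R) (omega : R -> R) (T : (X -> R) -> X -> \bar R) :
    \bar R :=
  ereal_inf [set L%:E | L in [set L : R | 0 <= L /\
    forall (f : X -> R) (B : set X), f \in Lfun mu r%:E -> balls BB B ->
      (osc B (T (fun x => (f x * \1_(~` hull B) x)%R)) <=
       L%:E * ereal_sup
         [set (omega (fine (mu A) / fine (mu B)))%:E * mean r (EFin \o f) A |
           A in [set A | balls BB A /\ B `<=` A]])%E]].

End ball_basis.

Definition inv_log2 (R : realType) (t : R) : R := (ln (1 + t) / ln 2)^-1.

(* Main.v *)
Require Import Defs.
From mathcomp Require Import all_boot all_order all_algebra.
From mathcomp Require Import all_classical all_reals all_analysis.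
From mathcomp Require Import ess_sup_inf hoelder.
From mathcomp Require Import measurable_realfun lra ring.
Import Order.TTheory GRing.Theory Num.Theory.
Import numFieldNormedType.Exports.
Local Open Scope classical_set_scope.
Local Open Scope ring_scope.

Set Implicit Arguments.
Unset Strict Implicit.
Unset Printing Implicit Defensive.

(** Each point [x] lies in a decreasing sequence of balls [cell n x]; the averages
    [cond_exp n f x] of [f] over them form a martingale, and all the operators are
    functions of the weighted sums of its increments [dif k f x]. The operators
    are defined by sums over balls, and a ball may occur at several levels;
    [mtransnE], [mtransn_partial] and [square_functionE] pass to sums over levels.

    The oscillation inequality is a matter of localisation. Let [g] be [f - f_B] on
    [B] and [0] elsewhere. The balls larger than [B] contribute to the transforms
    of [f] a constant on [B] and do not see [g], whose mean is [0]; the smaller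
    ones do not distinguish [f] from [g]. Hence [T f] differs on [B] from a constant
    by at most [|T g|], also for the suprema, the infimum and the square function
    ([operator_split]). The [L^r] norm of [g] is [mu(B)^(1/r)] times the sharp mean
    of [f] on [B], and the weak type bound of [T] at [g] leaves more than the share
    [beta] of [B] where [|T g|] is small ([osc_beta_bound], with [C = 2]).

    For the transform over all balls, which is a limit, this uses convergence
    almost everywhere, and boundedness on BMO uses a weak type estimate; both come
    from stopping. By doubling, a ball has at least a fixed proportion of the
    measure of its parent ([doubling_regular]). If increments are kept only until
    the average of [|f|] exceeds [lam], the stopped martingale is therefore bounded
    by a multiple of [lam] ([stopped_bound]), its increments are orthogonal
    ([mds_energy]), and Kolmogorov's inequality controls all their transforms
    ([kolmogorov]), while by Doob's inequality stopping is a rare event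
    ([doob_maximal]). This gives [partial_transform_cvg] and [weak_estimate].

    If [f] is in BMO, the weak type estimate at [g] shows that on every ball [T f]
    is within a multiple of the norm of [f] from a constant, off a small share of
    the ball ([operator_local]). By an argument of John and Nirenberg this local
    information on all balls bounds the moments of order [r]: the largest balls
    where [T f] is often far from its constant have small total measure and, again
    by regularity, comparable constants, so that their contribution to the moments
    can be absorbed ([moment_step], [dist_moment]). *)

(** * Integrals over a finite measure *)

Section finite_measure.
Context d (X : measurableType d) (R : realType).
Variable mu : {finite_measure set X -> \bar R}.
Local Notation m A := (fine (mu A)).

Lemma finite_fineK A : measurable A -> ((m A)%:E = mu A)%E.
Proof. by move=> mA; rewrite fineK// fin_num_measure. Qed.

Lemma m_le A B : measurable A -> measurable B -> A `<=` B -> m A <= m B.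
Proof.
move=> mA mB AB; rewrite -lee_fin !finite_fineK//.
by apply: le_measure; rewrite ?inE.
Qed.

Lemma m_setU A B : measurable A -> measurable B -> m (A `|` B) <= m A + m B.
Proof.
move=> mA mB; rewrite -lee_fin EFinD !finite_fineK//; last exact: measurableU.
exact: measureU2.
Qed.

Lemma m_setD A B : measurable A -> measurable B -> B `<=` A -> m (A `\` B) = m A - m B.
Proof.
move=> mA mB BA; apply/eqP; rewrite eq_sym subr_eq; apply/eqP.
have mD : measurable (A `\` B) by exact: measurableD.
apply: EFin_inj; rewrite EFinD !finite_fineK//.
rewrite -measureU//; last by rewrite setIC setDIK.
by rewrite setUC setDUK.
Qed.

Lemma integrable_sub (f : X -> R) B : measurable B ->
  mu.-integrable setT (EFin \o f) -> mu.-integrable B (EFin \o f).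
Proof. by move=> mB; apply: integrableS. Qed.

Lemma bounded_integrable (f : X -> R) (M : R) : measurable_fun setT f ->
  (forall x, `|f x| <= M) -> mu.-integrable setT (EFin \o f).
Proof.
move=> mf fM; apply: measurable_bounded_integrable => //.
  exact: fin_num_fun_lty.
exists M; split; first exact: num_real.
by move=> N MN x _ /=; apply: le_trans (fM x) _; exact: ltW.
Qed.

Lemma integral_const (c : R) B : measurable B ->
  (\int[mu]_(x in B) c%:E = (c * m B)%:E)%E.
Proof.
move=> mB; rewrite -[LHS]/(\int[mu]_(x in B) cst c%:E x)%E integral_cst//.
rewrite (EFinM c); congr (_ * _)%E; exact/esym/(finite_fineK mB).
Qed.

Lemma integral_indicE D Z : measurable D -> measurable Z ->
  (\int[mu]_(x in D) (\1_Z x)%:E = (m (Z `&` D))%:E)%E.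
Proof.
move=> mD mZ; rewrite integral_indic//; apply/esym/finite_fineK.
exact: measurableI.
Qed.

Lemma chebyshev_integral (A : set X) (c : R) (g : X -> \bar R) : measurable A ->
  0 <= c -> measurable_fun setT g -> (forall x, 0 <= g x)%E ->
  (forall x, A x -> c%:E <= g x)%E -> (c%:E * mu A <= \int[mu]_x g x)%E.
Proof.
move=> mA c0 mg g0 cg; rewrite -integral_cst//.
apply: (@le_trans _ _ (\int[mu]_(x in A) g x)%E).
  by apply: ge0_le_integral => //; exact: measurable_funTS.
by apply: ge0_subset_integral.
Qed.

Lemma scaled_measure_le (c V : R) (E : set X) : measurable E -> 0 < c ->
  (c%:E * mu E <= V%:E)%E -> m E <= V / c.
Proof.
move=> mE c0; rewrite -(finite_fineK mE) -EFinM lee_fin => H.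
by rewrite ler_pdivlMr// mulrC.
Qed.

Lemma small_measure_eq0 (A : set X) (c : R) : measurable A -> 0 < c ->
  (forall e : R, 0 < e -> (c%:E * mu A <= e%:E)%E) -> mu A = 0.
Proof.
move=> mA c0 H; rewrite -(finite_fineK mA); congr (_%:E); apply/eqP.
rewrite eq_le fine_ge0// andbT; apply/ler_addgt0Pr => e e0; rewrite add0r.
have := H (c * e) (mulr_gt0 c0 e0).
by rewrite -(finite_fineK mA) -EFinM lee_fin ler_pM2l.
Qed.

End finite_measure.

(** * The balls of the filtration *)

Section cells.
Context d (X : measurableType d) (R : realType).
Variable mu : {finite_measure set X -> \bar R}.
Variable BB : nat -> set (set X).
Hypothesis filt : filtration mu BB.

Lemma ball_measurable B : balls BB B -> measurable B.
Proof. by case=> n _; exact: filt_measurable filt _ _. Qed.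

Lemma ball_gt0 B : balls BB B -> (0 < mu B)%E.
Proof. by case=> n _; exact: filt_mu_gt0 filt _ _. Qed.

Lemma ball_setT : balls BB setT.
Proof. by exists 0%N => //; rewrite (filt0 filt). Qed.

Lemma ball_neq0 B : balls BB B -> B !=set0.
Proof. by case=> n _; case: (filt_partition filt n) => _ _; apply. Qed.

Definition cell n (x : X) : set X := get [set A | BB n A /\ A x].

Lemma cellP n x : BB n (cell n x) /\ cell n x x.
Proof.
have [U _ _] := filt_partition filt n.
have : (\bigcup_(A in BB n) A) x by move: U; rewrite /cover => ->.
by case=> A BA Ax; apply: (@getPex _ [set A | BB n A /\ A x]); exists A.
Qed.

Lemma cell_lev n x : BB n (cell n x). Proof. by have [] := cellP n x. Qed.
Lemma cell_self n x : cell n x x. Proof. by have [] := cellP n x. Qed.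
Lemma cell_ball n x : balls BB (cell n x).
Proof. by exists n => //; exact: cell_lev. Qed.

Lemma cell_eq n A x : BB n A -> A x -> cell n x = A.
Proof.
move=> BA Ax; have [_ T _] := filt_partition filt n.
apply: (T (cell n x) A) => //; first exact: cell_lev.
by exists x; split => //; exact: cell_self.
Qed.

Lemma cellS n x : cell n.+1 x `<=` cell n x.
Proof.
have [S SB E] := filt_refine filt (cell_lev n x).
have := cell_self n x; rewrite {1}E => -[B SBx Bx].
by rewrite (cell_eq (SB _ SBx) Bx) E => y By; exists B.
Qed.

Lemma cell_sub m n x : (m <= n)%N -> cell n x `<=` cell m x.
Proof.
move=> /subnK <-; elim: (n - m)%N => [|k IH] //.
by rewrite addSn; apply: subset_trans IH; exact: cellS.
Qed.

Lemma cell_congr m n x y : (m <= n)%N -> cell n x y -> cell m y = cell m x.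
Proof. by move=> mn xy; apply: cell_eq; [exact: cell_lev|exact: cell_sub xy]. Qed.

Lemma ball_nested m n A B x : (m <= n)%N -> BB m A -> BB n B -> A x -> B x ->
  B `<=` A.
Proof.
by move=> mn /cell_eq BA /cell_eq BB' /BA <- /BB' <-; exact: cell_sub.
Qed.

Lemma cell_stable i j x : (i <= j)%N -> cell j x = cell i x ->
  forall k, (i <= k <= j)%N -> cell k x = cell i x.
Proof.
move=> ij E k /andP[ik kj]; apply/seteqP; split; first exact: cell_sub.
by rewrite -E; exact: cell_sub.
Qed.

Lemma balls_countable : countable (balls BB).
Proof.
apply: bigcup_countable => // n _; exact: filt_countable filt n.
Qed.

(** Stopping balls: from level [k] on, each point of [B] keeps the first ball
    around it that has the property [P]. Excluding all larger balls with [P]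
    makes them disjoint. *)
Definition first_balls (P : set X -> Prop) k (B : set X) : set (set X) :=
  [set Q | Q `<=` B /\ exists n, [/\ (k <= n)%N, BB n Q, P Q &
    forall j A, (k <= j < n)%N -> BB j A -> Q `<=` A -> ~ P A]].

Lemma first_balls_triv P k B : trivIset (first_balls P k B) id.
Proof.
move=> Q1 Q2 [_ [n1 [kn1 B1 P1 F1]]] [_ [n2 [kn2 B2 P2 F2]]] [x [/= Qx1 Qx2]].
have [n12|n21|n12] := ltngtP n1 n2.
- exfalso; apply: (F2 n1 Q1) => //; first by rewrite kn1.
  exact: (ball_nested (ltnW n12) B1 B2 Qx1 Qx2).
- exfalso; apply: (F1 n2 Q2) => //; first by rewrite kn2.
  exact: (ball_nested (ltnW n21) B2 B1 Qx2 Qx1).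
- by rewrite -(cell_eq B1 Qx1) n12 (cell_eq B2 Qx2).
Qed.

Lemma first_balls_ball P k B Q : first_balls P k B Q -> balls BB Q.
Proof. by case=> _ [n [_ BQ _ _]]; exists n. Qed.

Lemma first_balls_cover P k B x : BB k B -> B x ->
  forall n, (k <= n)%N -> P (cell n x) -> (\bigcup_(Q in first_balls P k B) Q) x.
Proof.
move=> kB Bx n kn Pn.
pose p m := `[< (k <= m)%N /\ P (cell m x) >].
have ex : exists m, p m by exists n; apply/asboolP.
case: (ex_minnP ex) => m /asboolP[km Pm] min.
exists (cell m x); last exact: cell_self.
split; first by rewrite -(cell_eq kB Bx); exact: cell_sub.
exists m; split => //; first exact: cell_lev.
move=> j A /andP[kj jm] BA mA PA; have := min j; rewrite leqNgt jm => H.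
suff : false by []. apply: H; apply/asboolP; split => //.
by rewrite (cell_eq BA) //; apply: mA; exact: cell_self.
Qed.

(** The filler [set0] makes the list infinite, as countable additivity wants. *)
Lemma disjoint_balls_enum (Q : set (set X)) : Q `<=` balls BB -> trivIset Q id ->
  exists F : nat -> set X, [/\ trivIset setT F, forall i, measurable (F i),
    \bigcup_i F i = \bigcup_(A in Q) A & forall i, Q (F i) \/ F i = set0].
Proof.
move=> QB tQ.
have cQ : countable Q by apply: sub_countable balls_countable; exact: subset_card_le.
have [h hinj] : exists f : set X -> nat, {in Q &, injective f}.
  by move/countable_injP : cQ => [f fi]; exists f.
pose F i := \bigcup_(A in [set A | Q A /\ h A = i]) A.
have FE i A : Q A -> h A = i -> F i = A.
  move=> QA hA; apply/seteqP; split=> [x [B [QB' hB] Bx]|x Ax]; last by exists A.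
  by rewrite -(_ : B = A)//; apply: hinj; rewrite ?inE// hA.
have F0 i : Q (F i) \/ F i = set0.
  have [[A [QA hA]]|no] := pselect (exists A, Q A /\ h A = i).
    by left; rewrite (FE i A).
  right; apply/seteqP; split=> // x [A [QA hA] _]; apply: no; by exists A.
exists F; split=> //.
- move=> i j _ _ [x [[A [QA hA] Ax] [B [QB' hB] Bx]]].
  by rewrite -hA -hB; congr h; apply: tQ => //; exists x.
- move=> i; case: (F0 i) => [/QB|->]; first exact: ball_measurable.
  exact: measurable0.
- apply/seteqP; split=> x.
    by case=> i _ [A [QA hA] Ax]; exists A.
  by case=> A QA Ax; exists (h A) => //; exists A.
Qed.

Lemma disjoint_balls_measurable (Q : set (set X)) :
  Q `<=` balls BB -> trivIset Q id -> measurable (\bigcup_(A in Q) A).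
Proof.
move=> QB tQ; have [F [_ mF <- _]] := disjoint_balls_enum QB tQ.
exact: bigcup_measurable.
Qed.

(** The only way in which sums over balls enter: orthogonality of increments,
    Doob's inequality, the density argument and the covering argument of
    John and Nirenberg all compare two integrals ball by ball. *)
Lemma disjoint_balls_integral (Q : set (set X)) (f g : X -> \bar R) :
  Q `<=` balls BB -> trivIset Q id ->
  measurable_fun setT f -> measurable_fun setT g ->
  (forall x, 0 <= f x)%E -> (forall x, 0 <= g x)%E ->
  (forall A, Q A -> \int[mu]_(x in A) f x <= \int[mu]_(x in A) g x)%E ->
  (\int[mu]_(x in \bigcup_(A in Q) A) f x <=
   \int[mu]_(x in \bigcup_(A in Q) A) g x)%E.
Proof.
move=> QB tQ mf mg f0 g0 fg.
have [F [tF mF <- F0]] := disjoint_balls_enum QB tQ.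
rewrite !ge0_integral_bigcup//; [|exact: measurable_funTS..].
apply: lee_nneseries => [i _ _|i _]; first exact: integral_ge0.
by case: (F0 i) => [/fg//|->]; rewrite !integral_set0.
Qed.

(** Measurability with respect to the sigma-algebra of level [n]. *)
Definition level (T : Type) n (h : X -> T) := forall x y, cell n x y -> h y = h x.

Lemma level_cell n : level n (cell n).
Proof. by move=> x y; exact: cell_congr. Qed.

Lemma levelW T m n (h : X -> T) : (m <= n)%N -> level m h -> level n h.
Proof. by move=> mn hm x y xy; apply: hm; exact: cell_sub xy. Qed.

Lemma level_preimage T n (h : X -> T) U : level n h -> measurable (h @^-1` U).
Proof.
move=> lh; pose Q := [set A | BB n A /\ A `<=` h @^-1` U].
have -> : h @^-1` U = \bigcup_(A in Q) A.
  apply/seteqP; split=> [x Ux|x [A [BA AU] /AU//]].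
  exists (cell n x); last exact: cell_self.
  split; first exact: cell_lev.
  by move=> y /lh; rewrite /preimage/= => ->.
apply: disjoint_balls_measurable; first by move=> A [BA _]; exists n.
apply: (sub_trivIset (D' := BB n)); first by move=> A [].
by case: (filt_partition filt n).
Qed.

Lemma level_measurable d' (T : measurableType d') n (h : X -> T) :
  level n h -> measurable_fun setT h.
Proof. by move=> lh _ Y _; rewrite setTI; exact: level_preimage lh. Qed.

End cells.

(** * Increments along the levels *)

Section increments.
Context d (X : measurableType d) (R : realType).
Variable mu : {finite_measure set X -> \bar R}.
Variable BB : nat -> set (set X).
Hypothesis filt : filtration mu BB.
Local Notation cell := (cell BB).

Definition cond_exp n (f : X -> R) x : R := avg mu (EFin \o f) (cell n x).

Definition dif k (f : X -> R) x : R := cond_exp k.+1 f x - cond_exp k f x.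

(** A sum over levels, whereas [mtransn] sums over balls. *)
Definition partial_transform (eps : set X -> R) m (f : X -> R) x : R :=
  \sum_(k < m) eps (cell k x) * dif k f x.

(** The levels at which the ball around [x] shrinks. A ball that persists through
    several levels has its only nonzero increment at the last of them, so that
    the jumps list the balls that matter without repetition. *)
Definition jump x : set nat := [set k | cell k x <> cell k.+1 x].

Lemma jump_inj x : set_inj (jump x) (cell^~ x).
Proof.
have H i j : (i < j)%N -> jump x i -> cell i x <> cell j x.
  move=> ij Ji E; apply: Ji; apply/esym.
  by apply: (cell_stable filt (ltnW ij)) => //; rewrite leqnSn ij.
move=> i j; rewrite !inE => Ji Jj E.
by have [/H|/H|//] := ltngtP i j; [move=> /(_ Ji)|move=> /(_ Jj) /nesym].
Qed.

Lemma dif0 x k f : ~ jump x k -> dif k f x = 0.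
Proof. by move=> /contrapT E; rewrite /dif /cond_exp -E subrr. Qed.

Lemma mdiff_jump x k f : jump x k -> mdiff mu BB (cell k x) f x = dif k f x.
Proof.
move=> Jk; rewrite /mdiff -(fsbig_widen [set cell k.+1 x]).
- rewrite fsbig_set1 indicE mem_set ?mulr1//; exact: cell_self filt _ _.
- move=> _ ->; exists k; split; [exact: (cell_lev filt)..|exact: (cellS filt)].
- move=> B [[n [Bn An BA]] /= BN].
  have [Bx|nBx] := pselect (B x); last by rewrite indicE memNset// mulr0.
  have EB := cell_eq filt Bn Bx.
  have EA := cell_eq filt An (BA _ Bx).
  have [Jn|/contrapT E] := pselect (jump x n).
    by exfalso; apply: BN; rewrite -EB (jump_inj _ _ EA)// inE.
  by rewrite -EB -E EA subrr mul0r.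
Qed.

Lemma mdiff0 x A f : ~ ((cell^~ x) @` jump x) A -> mdiff mu BB A f x = 0.
Proof.
move=> noJ; apply: fsbig1 => B [n [Bn An BA]].
have [Bx|nBx] := pselect (B x); last by rewrite indicE memNset// mulr0.
have EB := cell_eq filt Bn Bx.
have EA := cell_eq filt An (BA _ Bx).
have [Jn|/contrapT E] := pselect (jump x n).
  by exfalso; apply: noJ; exists n.
by rewrite -EB -E EA subrr mul0r.
Qed.

Definition upto n : set (set X) := \bigcup_(k in [set k | (k <= n)%N]) BB k.

Lemma upto_le n k x : (k <= n)%N -> upto n (cell k x).
Proof. by move=> kn; exists k => //; exact: (cell_lev filt). Qed.

Lemma upto_anti n m k x : (m <= k)%N -> upto n (cell k x) -> upto n (cell m x).
Proof.
move=> mk [j /= jn Bj].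
have [mn|nm] := leqP m n; first exact: upto_le.
have E := cell_eq filt Bj (cell_self filt k x).
have jm : (j <= m)%N by rewrite (leq_trans jn)// ltnW.
rewrite (cell_stable filt (leq_trans jm mk) (esym E)) ?jm//.
exact: upto_le.
Qed.

Lemma jump_upto n x : exists m, forall k, jump x k -> upto n (cell k x) -> (k < m)%N.
Proof.
have [all|/existsNP[m nm]] := pselect (forall k, upto n (cell k x)).
  have E k : (n <= k)%N -> cell k x = cell n x.
    move=> nk; have [j /= jn Bj] := all k.
    have E := cell_eq filt Bj (cell_self filt k x).
    rewrite -E; apply/esym.
    by apply: (cell_stable filt (leq_trans jn nk)) => //; rewrite jn nk.
  exists n => k Jk _; rewrite ltnNge; apply/negP => nk; apply: Jk.
  by rewrite (E k nk) (E k.+1)// ltnW.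
exists m => k _ Uk; rewrite ltnNge; apply/negP => mk; apply: nm.
exact: upto_anti Uk.
Qed.

(** A ball of level at most [n] may persist beyond level [n], and its increment
    then occurs later. This is why the sum is cut by a weight, which depends on
    the ball only, and not at level [n]. For large [M] the sum is complete: either
    the weights have vanished, or the ball has stopped changing. *)
Lemma mtransnE n x : exists m, forall M, (m <= M)%N -> forall eps f,
  mtransn mu BB eps n f x =
  partial_transform (fun A => eps A * `[< upto n A >]%:R) M f x.
Proof.
have [m Hm] := jump_upto n x; exists m => M mM eps f.
pose K := jump x `&` [set k | upto n (cell k x)].
rewrite /mtransn -/(upto n) -(fsbig_widen ((cell^~ x) @` K)).
- rewrite fsbig_image; last by move=> i j /[!inE] -[? _] [? _]; apply: jump_inj; rewrite inE.
  rewrite /partial_transform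
    (fsbig_ord _ _ (fun k => eps (cell k x) * `[< upto n (cell k x) >]%:R * dif k f x)).
  rewrite -(fsbig_widen K `I_M).
  + apply: eq_fsbigr => k; rewrite inE => -[Jk Uk].
    by rewrite mdiff_jump// asboolT// mulr1.
  + by move=> k [Jk Uk] /=; rewrite (leq_trans _ mM)//; exact: Hm.
  + move=> k [_ /= nK].
    have [Jk|/dif0->] := pselect (jump x k); last by rewrite mulr0.
    by rewrite asboolF ?mulr0 ?mul0r// => Uk; apply: nK; split.
- by move=> _ [k [_ Uk] <-].
- move=> A [UA nA] /=; rewrite mdiff0 ?mulr0// => -[k Jk E].
  by apply: nA; exists k => //; split => //=; rewrite E.
Qed.

(** Along the levels the weights of [mtransnE] are [1] and then [0], so that they
    cut the sum at a level, at least [n] but depending on the point. *)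
Lemma mtransn_partial n x eps f :
  exists2 m, (n <= m)%N & mtransn mu BB eps n f x = partial_transform eps m f x.
Proof.
have [m Hm] := mtransnE n x.
have [all|/existsNP nall] := pselect (forall k, upto n (cell k x)).
  exists (maxn n m); first exact: leq_maxl.
  rewrite (Hm (maxn n m)) ?leq_maxr//; apply: eq_bigr => k _.
  by rewrite asboolT ?mulr1.
have ex : exists p, ~~ `[< upto n (cell p x) >].
  by case: nall => p np; exists p; apply/asboolPn.
case: (ex_minnP ex) => p /asboolPn np min.
have lt k : (k < p)%N -> upto n (cell k x).
  move=> kp; apply: contrapT => /asboolPn /min; by rewrite leqNgt kp.
exists p.
  by rewrite leqNgt; apply/negP => pn; apply: np; apply: upto_le; exact: ltnW.
rewrite (Hm (maxn p m)) ?leq_maxr// /partial_transform.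
rewrite [RHS](big_ord_widen (maxn p m)
  (fun k => eps (cell k x) * dif k f x)) ?leq_maxl// [RHS]big_mkcond.
apply: eq_bigr => k _; case: ltnP => [/lt Uk|pk].
  by rewrite asboolT ?mulr1.
rewrite asboolF ?mulr0 ?mul0r// => Uk; apply: np; exact: upto_anti Uk.
Qed.

Lemma square_functionE f x : square_function mu BB f x =
  ((\sum_(0 <= k <oo) (dif k f x ^+ 2)%:E) `^ 2^-1)%E.
Proof.
rewrite /square_function; congr poweR.
rewrite nneseries_esumT; last by move=> k; rewrite lee_fin sqr_ge0.
rewrite esum_mkcond [RHS]esum_mkcond.
transitivity (\esum_(A in (cell^~ x) @` jump x) (`|mdiff mu BB A f x| ^+ 2)%:E)%E.
  rewrite [RHS]esum_mkcond; apply: eq_esum => A _.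
  have [Ai|nA] := pselect (((cell^~ x) @` jump x) A).
    rewrite !mem_set//; case: Ai => k _ <-; exact: (cell_ball filt).
  by rewrite (memNset nA) mdiff0// normr0 expr0n/= if_same.
rewrite esum_image; last exact: jump_inj.
rewrite [LHS]esum_mkcond; apply: eq_esum => k _; rewrite in_setT.
have [Jk|nJ] := pselect (jump x k).
  by rewrite mem_set// mdiff_jump// real_normK// num_real.
by rewrite memNset// dif0// expr0n.
Qed.

End increments.

(** * Regularity of the filtration *)

Section regularity.
Context d (X : measurableType d) (R : realType).
Variable mu : {finite_measure set X -> \bar R}.
Variable BB : nat -> set (set X).
Hypothesis filt : filtration mu BB.
Local Notation cell := (cell BB).
Local Notation m A := (fine (mu A)).

Lemma m_gt0 B : balls BB B -> 0 < m B.
Proof.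
by move=> bB; rewrite -lte_fin finite_fineK ?(ball_gt0 filt)//; exact: ball_measurable filt _ bB.
Qed.

Definition regular (eta : R) := forall n A B, BB n A -> BB n.+1 B -> B `<=` A ->
  m A <= eta * m B.

(** The candidate of least level is maximal, since balls that meet are nested. *)
Lemma hull_exists B : balls BB B -> exists H, is_hull mu BB B H.
Proof.
move=> bB; pose p n := `[< exists2 A, BB n A & B `<=` A /\ (mu A <= 2%:E * mu B)%E >].
have ex : exists n, p n.
  case: (bB) => n _ Bn; exists n; apply/asboolP; exists B => //; split => //.
  by rewrite -[leLHS]mul1e lee_wpmul2r// lee_fin ler1n.
case: (ex_minnP ex) => n /asboolP[H Hn [BH mH]] min.
exists H; split; first by split => //; exists n.
move=> A [[k _ Ak] BA mA] HA.
have nk : (n <= k)%N by apply: min; apply/asboolP; exists A.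
have [x Bx] := ball_neq0 filt bB.
apply/seteqP; split => //.
exact: ball_nested filt _ _ _ _ _ nk Hn Ak (BH _ Bx) (BA _ Bx).
Qed.

(** A ball around [B] of measure at least [2 * m B] is not [B], hence contains
    the parent of [B]. If doubling provides no such ball, the hull is the whole
    space and [B] fills at least half of it. *)
Lemma doubling_regular : doubling mu BB -> exists2 eta : R, 1 <= eta & regular eta.
Proof.
case=> eta eta2 dbl; exists eta; first by lra.
move=> n A B An Bn BA.
have bB : balls BB B by exists n.+1.
have mA := ball_measurable filt (ex_intro2 _ _ n I An : balls BB A).
have mB := ball_measurable filt bB.
have B0 := m_gt0 bB.
have [E|/eqP AB] := eqVneq A B; first by rewrite E ler_peMl ?(ltW B0)//; lra.
have [HT|HnT] := pselect (hull mu BB B = setT).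
  have [[_ _ le] _] : is_hull mu BB B (hull mu BB B).
    by apply: getPex; exact: hull_exists.
  rewrite -lee_fin EFinM !finite_fineK//.
  apply: (@le_trans _ _ (mu setT)); first by apply: le_measure; rewrite ?inE.
  rewrite -HT (le_trans le)// lee_wpmul2r// lee_fin; lra.
have [B' [[k _ Bk] BB' lo hi]] := dbl B bB HnT.
rewrite -lee_fin EFinM !finite_fineK//; apply: le_trans hi.
have mB' := ball_measurable filt (ex_intro2 _ _ k I Bk : balls BB B').
apply: le_measure; rewrite ?inE//.
have [x Bx] := ball_neq0 filt bB.
have [nk|kn] := ltnP n k.
  have : B' `<=` B by exact: ball_nested filt _ _ _ _ _ nk Bn Bk Bx (BB' _ Bx).
  move=> B'B; have E : B' = B by apply/seteqP; split.
  move: lo; rewrite E -(finite_fineK mu mB) -EFinM lee_fin; lra.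
exact: ball_nested filt _ _ _ _ _ kn Bk An (BB' _ Bx) (BA _ Bx).
Qed.

(** The positive and the negative part have equal integrals over the balls of
    level [n], and these add up. *)
Lemma integral0_up k n (f : X -> R) : (k <= n)%N -> mu.-integrable setT (EFin \o f) ->
  (forall B, BB n B -> \int[mu]_(x in B) (f x)%:E = 0)%E ->
  forall A, BB k A -> (\int[mu]_(x in A) (f x)%:E = 0)%E.
Proof.
move=> kn fi f0 A Ak.
have mf := measurable_int mu fi.
pose Q := [set B | BB n B /\ B `<=` A].
have QB : Q `<=` balls BB by move=> B [Bn _]; exists n.
have tQ : trivIset Q id.
  apply: (sub_trivIset (D' := BB n)); first by move=> B [].
  by case: (filt_partition filt n).
have AE : A = \bigcup_(B in Q) B.
  apply/seteqP; split=> [x Ax|x [B [_ BA] /BA//]].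
  exists (cell n x); last exact: cell_self filt n x.
  split; first exact: cell_lev filt n x.
  by rewrite -(cell_eq filt Ak Ax); exact: cell_sub filt _ _ _ kn.
have bE B : balls BB B -> mu.-integrable B (EFin \o f).
  move=> bB; apply: integrableS fi => //; exact: ball_measurable filt _ bB.
have E B : Q B -> (\int[mu]_(x in B) (EFin \o f)^\+ x =
    \int[mu]_(x in B) (EFin \o f)^\- x)%E.
  move=> QB'; have iB := bE _ (QB _ QB').
  have mB := ball_measurable filt (QB _ QB').
  have := f0 B QB'.1; rewrite integralE => /eqP; rewrite sube_eq; first by rewrite add0e => /eqP.
    exact: integrable_pos_fin_num.
  by rewrite fin_num_adde_defl// integrable_neg_fin_num.
have bA : balls BB A by exists k.
have iA := bE A bA; have mA := ball_measurable filt bA.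
rewrite integralE; apply/eqP; rewrite sube_eq ?add0e; last 2 first.
- exact: integrable_pos_fin_num.
- by rewrite fin_num_adde_defl// integrable_neg_fin_num.
rewrite eq_le AE; apply/andP; split; apply: (disjoint_balls_integral filt) => //;
  try (by move=> x; rewrite ?funepos_ge0 ?funeneg_ge0);
  try (exact: measurable_funepos); try (exact: measurable_funeneg).
- by move=> B /E ->.
- by move=> B /E ->.
Qed.

End regularity.

(** * Bounded martingale differences *)

Section martingale_differences.
Context d (X : measurableType d) (R : realType).
Variable mu : {finite_measure set X -> \bar R}.
Variable BB : nat -> set (set X).
Hypothesis filt : filtration mu BB.
Local Notation level := (level BB).

(** Boundedness makes all products integrable. *)
Definition bounded_level n (f : X -> R) :=
  level n f /\ exists M, forall x, `|f x| <= M.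

Lemma bounded_levelW k n f : (k <= n)%N -> bounded_level k f -> bounded_level n f.
Proof. by move=> kn [lf bf]; split => //; exact: levelW filt _ _ _ _ kn lf. Qed.

Lemma bounded_level_cst n c : bounded_level n (fun=> c).
Proof. by split=> //; exists `|c|. Qed.

Lemma bounded_levelD n f g : bounded_level n f -> bounded_level n g ->
  bounded_level n (fun x => f x + g x).
Proof.
move=> [lf [M fM]] [lg [N gN]]; split=> [x y xy|]; first by rewrite (lf _ _ xy) (lg _ _ xy).
by exists (M + N) => x; rewrite (le_trans (ler_normD _ _))// lerD.
Qed.

Lemma bounded_levelM n f g : bounded_level n f -> bounded_level n g ->
  bounded_level n (fun x => f x * g x).
Proof.
move=> [lf [M fM]] [lg [N gN]]; split=> [x y xy|]; first by rewrite (lf _ _ xy) (lg _ _ xy).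
by exists (M * N) => x; rewrite normrM ler_pM.
Qed.

Lemma bounded_level_sum n k (F : nat -> X -> R) :
  (forall i, (i < k)%N -> bounded_level n (F i)) ->
  bounded_level n (fun x => \sum_(i < k) F i x).
Proof.
elim: k => [|k IH] H.
  have -> : (fun x => \sum_(i < 0) F i x) = fun=> 0 by apply/funext => x; rewrite big_ord0.
  exact: bounded_level_cst.
have -> : (fun x => \sum_(i < k.+1) F i x) = fun x => \sum_(i < k) F i x + F k x.
  by apply/funext => x; rewrite big_ord_recr.
apply: bounded_levelD; last exact: H.
by apply: IH => i ik; apply: H; rewrite ltnW.
Qed.

Lemma bounded_level_measurable n f : bounded_level n f -> measurable_fun setT f.
Proof. by case=> lf _; exact: level_measurable filt _ _ _ _ lf. Qed.

Lemma bounded_level_integrable n f : bounded_level n f ->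
  mu.-integrable setT (EFin \o f).
Proof.
move=> bf; have mf := bounded_level_measurable bf; case: bf => _ [M fM].
exact: bounded_integrable mf fM.
Qed.

(** Bounded martingale differences. *)
Definition mds (h : nat -> X -> R) := forall k, bounded_level k.+1 (h k) /\
  forall A, BB k A -> (\int[mu]_(x in A) (h k x)%:E = 0)%E.

Definition psum (h : nat -> X -> R) n x := \sum_(k < n) h k x.

Lemma bounded_level_psum h n : mds h -> bounded_level n (psum h n).
Proof.
move=> hh; apply: bounded_level_sum => i ni.
by have [bh _] := hh i; exact: bounded_levelW bh.
Qed.

(** Predictable weights preserve martingale differences. *)
Lemma mds_weight h (v : nat -> X -> R) : mds h ->
  (forall k, bounded_level k (v k)) -> mds (fun k x => v k x * h k x).
Proof.
move=> hh vv k; have [bh h0] := hh k; split.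
  by apply: bounded_levelM => //; apply: bounded_levelW (vv k).
move=> A Ak; have [x Ax] := ball_neq0 filt (ex_intro2 _ _ k I Ak : balls BB A).
have mA := ball_measurable filt (ex_intro2 _ _ k I Ak : balls BB A).
rewrite (eq_integral (fun y => (v k x)%:E * (h k y)%:E)%E).
  rewrite integralZl ?h0 ?mule0//; apply: integrableS (bounded_level_integrable bh) => //.
move=> y; rewrite inE => Ay; rewrite EFinM; congr (_%:E * _)%E.
by apply: (vv k).1; rewrite (cell_eq filt Ak Ax).
Qed.

Lemma mds_orthogonal k f h : bounded_level k f -> bounded_level k.+1 h ->
  (forall A, BB k A -> (\int[mu]_(x in A) (h x)%:E = 0)%E) ->
  \int[mu]_x (f x * h x) = 0.
Proof.
move=> bf bh h0.
have bfh : bounded_level k.+1 (fun x => f x * h x).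
  by apply: bounded_levelM => //; apply: bounded_levelW bf.
rewrite /Rintegral (@integral0_up _ _ _ mu BB filt 0 k)//.
- exact: bounded_level_integrable bfh.
- move=> A Ak; have [x Ax] := ball_neq0 filt (ex_intro2 _ _ k I Ak : balls BB A).
  have mA := ball_measurable filt (ex_intro2 _ _ k I Ak : balls BB A).
  rewrite (eq_integral (fun y => (f x)%:E * (h y)%:E)%E).
    by rewrite integralZl ?h0 ?mule0//; apply: integrableS (bounded_level_integrable bh).
  move=> y; rewrite inE => Ay; rewrite EFinM; congr (_%:E * _)%E.
  by apply: bf.1; rewrite (cell_eq filt Ak Ax).
- by rewrite (filt0 filt).
Qed.

(** Orthogonality of the increments. *)
Lemma mds_energy h n : mds h ->
  \int[mu]_x (psum h n x ^+ 2) = \sum_(k < n) \int[mu]_x (h k x ^+ 2).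
Proof.
move=> hh; elim: n => [|n IH].
  rewrite big_ord0 (@eq_Rintegral _ _ _ mu setT (fun=> 0)) ?Rintegral_cst// ?mul0r//.
  by move=> x _; rewrite /psum big_ord0 expr0n.
rewrite big_ord_recr/= -IH.
have bS := bounded_level_psum n hh; have [bh h0] := hh n.
have bS1 := bounded_levelW (leqnSn n) bS.
transitivity (\int[mu]_x (psum h n x ^+ 2 + (2 * (psum h n x * h n x) + h n x ^+ 2))).
  by apply: eq_Rintegral => x _; rewrite /psum big_ord_recr/=; ring.
have iS := bounded_level_integrable (bounded_levelM bS bS).
have ih := bounded_level_integrable (bounded_levelM bh bh).
have ix := bounded_level_integrable (bounded_levelM bS1 bh).
have ix2 := bounded_level_integrable (bounded_levelM (bounded_level_cst n.+1 2) (bounded_levelM bS1 bh)).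
rewrite RintegralD//; last first.
  exact: bounded_level_integrable (bounded_levelD
    (bounded_levelM (bounded_level_cst n.+1 2) (bounded_levelM bS1 bh)) (bounded_levelM bh bh)).
rewrite RintegralD// RintegralZl// (mds_orthogonal bS bh h0) mulr0 add0r.
by [].
Qed.

(** Kolmogorov's maximal inequality: sums that are stopped once they exceed [t]
    remain above [t], and stopping, a predictable weight, does not increase their
    energy. *)
Lemma kolmogorov h (t V : R) : mds h -> 0 < t ->
  (forall n, \sum_(k < n) \int[mu]_x (h k x ^+ 2) <= V) ->
  ((t ^+ 2)%:E * mu [set x | exists n, (t < `|psum h n x|)%R] <= V%:E)%E.
Proof.
move=> hh t0 HV.
pose v k x : R := `[< forall j, (j <= k)%N -> `|psum h j x| <= t >]%:R.
have bv k : bounded_level k (v k).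
  split=> [x y xy|]; last first.
    by exists 1 => x; rewrite ger0_norm ?ler0n// /v lern1 leq_b1.
  rewrite /v; congr (_%:R); congr (nat_of_bool _); apply/asboolP/asboolP => H j jk;
    have := H j jk; have [lS _] := bounded_level_psum j hh;
    by rewrite (levelW filt jk lS xy).
have hv := mds_weight hh bv.
pose S' := psum (fun k x => v k x * h k x).
have v01 k x : v k x = 0 \/ v k x = 1 by rewrite /v; case: (`[< _ >]); [right|left].
have energy n : \int[mu]_x (S' n x ^+ 2) <= V.
  rewrite mds_energy//; apply: le_trans (HV n).
  apply: ler_sum => k _; have [bh _] := hh k; have [bvh _] := hv k.
  apply: le_Rintegral => //.
  - exact: bounded_level_integrable (bounded_levelM bvh bvh).
  - exact: bounded_level_integrable (bounded_levelM bh bh).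
  - move=> x _; have [->|->] := v01 k x; last by rewrite mul1r.
    by rewrite mul0r expr0n/= sqr_ge0.
pose E n := [set x | exists2 j, (j <= n)%N & t < `|psum h j x|].
have mE n : measurable (E n).
  have -> : E n = \bigcup_(j in [set j | (j <= n)%N]) (fun x => `|psum h j x|) @^-1` [set y | t < y].
    by apply/seteqP; split=> [x [j jn tx]|x [j /= jn tx]]; exists j.
  apply: bigcup_measurable => j _.
  apply: (@level_preimage _ _ _ mu BB filt _ j).
  by have [lS _] := bounded_level_psum j hh => x y xy; rewrite (lS x y xy).
have key n x : E n x -> t ^+ 2 <= S' n x ^+ 2.
  move=> [j0 j0n tj0].
  pose p j := t < `|psum h j x|.
  have ex : exists j, p j by exists j0.
  case: (ex_minnP ex) => j pj min.
  have jn : (j <= n)%N by apply: leq_trans j0n; exact: min.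
  have lt i : (i < j)%N -> `|psum h i x| <= t.
    by move=> ij; rewrite leNgt; apply/negP => /min; rewrite leqNgt ij.
  suff -> : S' n x = psum h j x.
    by rewrite -[leRHS]real_normK ?num_real// ler_pXn2r ?nnegrE// ?(ltW t0)// ltW.
  rewrite /S' /psum (big_ord_widen n (fun k => h k x)) // [RHS]big_mkcond.
  apply: eq_bigr => k _; case: ltnP => kj.
    rewrite /v asboolT ?mul1r// => i ik; apply: lt; exact: leq_ltn_trans kj.
  rewrite /v asboolF ?mul0r// => H; have := H j kj; rewrite leNgt.
  by rewrite -/(p j) pj.
have mEV n : ((t ^+ 2)%:E * mu (E n) <= V%:E)%E.
  apply: (@le_trans _ _ (\int[mu]_x (S' n x ^+ 2)%:E)%E).
    apply: chebyshev_integral => //.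
    - exact: sqr_ge0.
    - apply/measurable_EFinP.
      have bS := bounded_level_psum n hv.
      exact: bounded_level_measurable (bounded_levelM bS bS).
    - by move=> x; rewrite lee_fin sqr_ge0.
    - by move=> x /key; rewrite lee_fin.
  have bS := bounded_level_psum n hv.
  rewrite -[leLHS]fineK; first by rewrite lee_fin; exact: energy.
  exact: integrable_fin_num (bounded_level_integrable (bounded_levelM bS bS)).
have -> : [set x | exists n, (t < `|psum h n x|)%R] = \bigcup_n E n.
  by apply/seteqP; split=> [x [n tn]|x [n _ [j _ tj]]]; [exists n => //; exists n|exists j].
have c : (fun n => (t ^+ 2)%:E * mu (E n))%E @ \oo --> ((t ^+ 2)%:E * mu (\bigcup_n E n))%E.
  apply: cvgeZl => //; apply: nondecreasing_cvg_mu => //.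
    exact: bigcup_measurable.
  move=> a b ab; apply/subsetPset => x [j ja tj]; exists j => //.
  exact: leq_trans ab.
rewrite -(cvg_lim _ c)//; apply: lime_le; first by apply/cvg_ex; eexists; exact: c.
exact: nearW.
Qed.

End martingale_differences.

(** * Almost everywhere convergence of square-summable differences *)

Section convergence.
Context d (X : measurableType d) (R : realType).
Variable mu : {finite_measure set X -> \bar R}.
Variable BB : nat -> set (set X).
Hypothesis filt : filtration mu BB.
Local Notation level := (level BB).

Lemma level_psum h n : mds mu BB h -> level n (psum h n).
Proof. by move=> hh; have [] := bounded_level_psum filt n hh. Qed.

Lemma exceed_measurable h (t : R) : mds mu BB h ->
  measurable [set x | exists n, t < `|psum h n x|].
Proof.
move=> hh; have -> : [set x | exists n, t < `|psum h n x|] =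
    \bigcup_n (fun x => `|psum h n x|) @^-1` [set y | t < y].
  by apply/seteqP; split=> [x [n tn]|x [n _ tn]]; exists n.
apply: bigcup_measurable => n _; apply: (@level_preimage _ _ _ mu BB filt _ n).
by move=> x y xy; rewrite (level_psum hh xy).
Qed.

(** Square-summable martingale differences converge almost everywhere, by
    Kolmogorov's inequality applied to the tails. *)
Lemma mds_cvg h (V : R) : mds mu BB h ->
  (forall n, \sum_(k < n) \int[mu]_x (h k x ^+ 2) <= V) ->
  mu.-negligible [set x | ~ cvgn (fun n => psum h n x)].
Proof.
move=> hh HV; pose u n := \sum_(k < n) \int[mu]_x (h k x ^+ 2).
pose tail K k x := (K <= k)%:R * h k x.
have htail K : mds mu BB (tail K).
  apply: (mds_weight filt hh (v := fun k _ => (K <= k)%:R)) => k.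
  exact: bounded_level_cst.
have tailE K n x : psum h (K + n) x = psum h K x + psum (tail K) (K + n) x.
  rewrite /psum !big_split_ord/=; congr (_ + _).
  rewrite [X in _ = X + _]big1 ?add0r; last first.
    by move=> i _; rewrite /tail leqNgt ltn_ord mul0r.
  by apply: eq_bigr => i _; rewrite /tail leq_addr mul1r.
have hsu : has_sup (range u).
  by split; [exists (u 0%N); exists 0%N|exists V => _ [n _ <-]; exact: HV].
have energy K n : \sum_(k < n) \int[mu]_x (tail K k x ^+ 2) <= sup (range u) - u K.
  rewrite lerBrDl; apply: (@le_trans _ _ (u (K + n)%N)); last first.
    by apply: ub_le_sup; [exact: hsu.2|exists (K + n)%N].
  rewrite /u big_split_ord/= lerD2l.
  apply: (@le_trans _ _ (\sum_(k < K + n) \int[mu]_x (tail K k x ^+ 2))).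
    rewrite addnC big_split_ord/= lerDl; apply: sumr_ge0 => i _.
    by apply: Rintegral_ge0 => x _; exact: sqr_ge0.
  rewrite big_split_ord/= big1 ?add0r.
    by apply: ler_sum => i _; rewrite /tail leq_addr;
      under eq_Rintegral do rewrite mul1r.
  move=> i _; rewrite /tail leqNgt ltn_ord.
  under eq_Rintegral do rewrite mul0r expr0n.
  by rewrite Rintegral_cst ?mul0r.
pose E K j := [set x | exists n, j.+1%:R^-1 < `|psum (tail K) n x|].
have mE K j : measurable (E K j) by exact: exceed_measurable (htail K).
have mN j : measurable (\bigcap_K E K j) by exact: bigcap_measurable.
have N0 j : mu (\bigcap_K E K j) = 0.
  apply: (@small_measure_eq0 _ _ _ mu _ (j.+1%:R^-1 ^+ 2)) => //.
  move=> e e0; have [_ [K _ <-] uK] := sup_adherent e0 hsu.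
  apply: (@le_trans _ _ ((j.+1%:R^-1 ^+ 2)%:E * mu (E K j))%E).
    apply: lee_wpmul2l; first by rewrite lee_fin sqr_ge0.
    by apply: le_measure; rewrite ?inE//; apply: bigcap_inf.
  apply: (le_trans (kolmogorov filt (htail K) _ (energy K))).
    by rewrite invr_gt0.
  by rewrite lee_fin lerBlDr -lerBlDl ltW.
exists (\bigcup_j \bigcap_K E K j); split.
- exact: bigcup_measurable.
- apply/negligibleP; first exact: bigcup_measurable.
  apply: (@negligible_bigcup _ _ _ mu) => j; exists (\bigcap_K E K j).
  by split => //; exact: N0.
move=> x /= ncv; apply: contrapT => nN; apply: ncv.
apply/cauchy_cvgP/cauchy_exP => e e0.
have [j je] : exists j, j.+1%:R^-1 < e.
  have [j _ H] := near_infty_natSinv_lt (PosNum e0).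
  by exists j; apply: (H j) => /=.
have [K nK] : exists K, ~ E K j x.
  apply: contrapT => /forallNP H; apply: nN; exists j => // K _.
  by apply: contrapT; exact: H.
exists (psum h K x); exists K => // n /= Kn.
rewrite /ball/= -(subnKC Kn) tailE opprD addrA subrr add0r normrN.
apply: le_lt_trans je; rewrite leNgt; apply/negP => lt; apply: nK.
by eexists; exact: lt.
Qed.

End convergence.

(** * Averages on balls *)

Section averages.
Context d (X : measurableType d) (R : realType).
Variable mu : {finite_measure set X -> \bar R}.
Variable BB : nat -> set (set X).
Hypothesis filt : filtration mu BB.
Local Notation cell := (cell BB).
Local Notation level := (level BB).
Local Notation m A := (fine (mu A)).
Local Notation cond_exp := (cond_exp mu BB).
Local Notation dif := (dif mu BB).

Lemma level_cond_exp n f : level n (cond_exp n f).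
Proof. by move=> x y xy; rewrite /cond_exp (level_cell filt xy). Qed.

Lemma level_dif k f : level k.+1 (dif k f).
Proof.
move=> x y xy; rewrite /dif (level_cond_exp f xy).
by rewrite (levelW filt (leqnSn k) (level_cond_exp f) xy).
Qed.

Lemma avgE f B : mu.-integrable setT (EFin \o f) -> balls BB B ->
  ((avg mu (EFin \o f) B * m B)%:E = \int[mu]_(x in B) (f x)%:E)%E.
Proof.
move=> fi bB; have mB := ball_measurable filt bB.
rewrite /avg divfK ?gt_eqF ?(m_gt0 filt bB)// fineK//.
by apply: integrable_fin_num => //; exact: integrable_sub fi.
Qed.

Lemma avg_norm f B : mu.-integrable setT (EFin \o f) -> balls BB B ->
  `|avg mu (EFin \o f) B| <= avg mu (EFin \o (fun x => `|f x|)) B.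
Proof.
move=> fi bB; have mB := ball_measurable filt bB.
rewrite /avg normrM [`|_^-1|]ger0_norm ?invr_ge0 ?fine_ge0//.
rewrite ler_wpM2r ?invr_ge0 ?fine_ge0//.
by apply: (@le_normr_Rintegral _ _ _ mu B f) => //; exact: integrable_sub fi.
Qed.

Lemma avg_parent eta (f : X -> R) n x : regular mu BB eta ->
  mu.-integrable setT (EFin \o f) -> (forall x, 0 <= f x) ->
  cond_exp n.+1 f x <= eta * cond_exp n f x.
Proof.
move=> reg fi f0; rewrite /cond_exp.
set A := cell n x; set B := cell n.+1 x.
have bA : balls BB A := cell_ball filt n x.
have bB : balls BB B := cell_ball filt n.+1 x.
have BA : B `<=` A by exact: (cellS filt).
have A0 := m_gt0 filt bA; have B0 := m_gt0 filt bB.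
have le : avg mu (EFin \o f) B * m B <= avg mu (EFin \o f) A * m A.
  rewrite -lee_fin !avgE//; apply: ge0_subset_integral => //.
  - exact: ball_measurable filt _ bB.
  - exact: ball_measurable filt _ bA.
  - by apply: measurable_funTS; exact: measurable_int fi.
  - by move=> y _; rewrite lee_fin.
have a0 : 0 <= avg mu (EFin \o f) A.
  rewrite /avg divr_ge0// fine_ge0//; apply: integral_ge0 => y _.
  by rewrite lee_fin.
have r := reg n A B (cell_lev filt n x) (cell_lev filt n.+1 x) BA.
rewrite -(ler_pM2r B0); apply: (le_trans le).
have -> : eta * avg mu (EFin \o f) A * m B = avg mu (EFin \o f) A * (eta * m B) by ring.
exact: ler_wpM2l.
Qed.

(** [cond_exp n f] and [f] have the same integrals over balls. The weight, which
    will cut off large averages, keeps the integrand integrable. *)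
Lemma cond_exp_centred n w f : mu.-integrable setT (EFin \o f) ->
  bounded_level BB n w -> (exists M : R, forall x, `|w x * cond_exp n f x| <= M) ->
  mu.-integrable setT (EFin \o (fun x => w x * cond_exp n f x - w x * f x)) /\
  forall k A, (k <= n)%N -> BB k A ->
    (\int[mu]_(x in A) (w x * cond_exp n f x - w x * f x)%:E = 0)%E.
Proof.
move=> fi bw bce.
have b1 : bounded_level BB n (fun x => w x * cond_exp n f x).
  by split=> // x y xy; rewrite (bw.1 _ _ xy) (level_cond_exp f xy).
have i1 := bounded_level_integrable filt b1.
have i2 : mu.-integrable setT (EFin \o (fun x => w x * f x)).
  case: bw => lw [M wM].
  have M0 : 0 <= M by apply: le_trans (wM point).
  have iM := integrableZl (measurableT) M fi.
  apply: le_integrable iM => //.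
    apply/measurable_EFinP; apply: measurable_funM.
      exact: level_measurable filt _ _ _ _ lw.
    by apply/measurable_EFinP; exact: measurable_int fi.
  by move=> x _ /=; rewrite lee_fin !normrM (ger0_norm M0) ler_wpM2r.
have i3 : mu.-integrable setT (EFin \o (fun x => w x * cond_exp n f x - w x * f x)).
  exact: (integrableB measurableT i1 i2).
split=> // k A kn Ak; apply: (integral0_up filt kn) => // B Bn.
have bB : balls BB B by exists n.
have mB := ball_measurable filt bB.
have [y By] := ball_neq0 filt bB.
rewrite (eq_integral (fun x => (w y)%:E * ((avg mu (EFin \o f) B)%:E - (f x)%:E))%E); last first.
  move=> x; rewrite inE => Bx; rewrite -EFinB -EFinM mulrBr; congr (_%:E).
  rewrite /cond_exp (cell_eq filt Bn Bx).
  by rewrite (bw.1 y x)// (cell_eq filt Bn By).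
have fiB : mu.-integrable B (EFin \o f) by exact: integrable_sub fi.
have ci : mu.-integrable B (EFin \o cst (avg mu (EFin \o f) B)).
  apply: integrable_sub => //.
  exact: bounded_level_integrable filt _ _ (bounded_level_cst BB 0 _).
rewrite integralZl//; last exact: integrableB.
rewrite [X in (_ * X)%E](_ : _ = 0%E) ?mule0//.
by rewrite (integralB mB ci fiB) /= integral_const// -avgE// subee.
Qed.

End averages.

(** * Stopping at large averages *)

Section stopped_transform.
Context d (X : measurableType d) (R : realType).
Variable mu : {finite_measure set X -> \bar R}.
Variable BB : nat -> set (set X).
Hypothesis filt : filtration mu BB.
Variable eta : R.
Hypothesis eta1 : 1 <= eta.
Hypothesis reg : regular mu BB eta.
Local Notation cell := (cell BB).
Local Notation m A := (fine (mu A)).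
Local Notation cond_exp := (cond_exp mu BB).
Local Notation dif := (dif mu BB).
Local Notation absf f := (fun x => `|f x|).

Let eta0 : 0 <= eta. Proof. exact: le_trans ler01 eta1. Qed.

Section fixed_function.
Variables (f : X -> R) (lam : R).
Hypothesis fi : mu.-integrable setT (EFin \o f).
Hypothesis lam0 : 0 < lam.

Lemma integrable_absf : mu.-integrable setT (EFin \o absf f).
Proof. exact: (integrable_abse fi). Qed.

Lemma cond_exp_norm n x : `|cond_exp n f x| <= cond_exp n (absf f) x.
Proof. by apply: (avg_norm filt fi); exact: cell_ball filt n x. Qed.

(** The weight that keeps the increments until the average of [|f|] exceeds
    [lam]. *)
Definition stop_weight k x : R :=
  `[< forall j, (j <= k)%N -> cond_exp j (absf f) x <= lam >]%:R.

Lemma stop_weight01 k x : stop_weight k x = 0 \/ stop_weight k x = 1 /\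
  forall j, (j <= k)%N -> cond_exp j (absf f) x <= lam.
Proof.
rewrite /stop_weight; case: (asboolP (forall j, (j <= k)%N -> cond_exp j (absf f) x <= lam)) => H.
  by right.
by left.
Qed.

Lemma bounded_level_stop_weight k : bounded_level BB k (stop_weight k).
Proof.
split=> [x y xy|]; last first.
  by exists 1 => x; rewrite ger0_norm ?ler0n// /stop_weight lern1 leq_b1.
rewrite /stop_weight; congr (_%:R); congr (nat_of_bool _).
by apply/asboolP/asboolP => H j jk; have := H j jk;
  rewrite (levelW filt jk (level_cond_exp filt (n:=j) (absf f)) xy).
Qed.

Lemma cond_exp_stop k x : (forall j, (j <= k)%N -> cond_exp j (absf f) x <= lam) ->
  `|cond_exp k f x| <= lam /\ `|cond_exp k.+1 f x| <= eta * lam.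
Proof.
move=> H; have Hk := H k (leqnn k); split; first exact: le_trans (cond_exp_norm k x) Hk.
apply: (le_trans (cond_exp_norm k.+1 x)).
apply: (le_trans (avg_parent filt k x reg integrable_absf _)) => //.
exact: ler_wpM2l eta0 _ _ Hk.
Qed.

Definition stopped k x := stop_weight k x * dif k f x.

Lemma mds_stopped : mds mu BB stopped.
Proof.
move=> k.
have bw := bounded_level_stop_weight k.
have [C1 C2] : (exists M : R, forall x, `|stop_weight k x * cond_exp k.+1 f x| <= M) /\
         exists M : R, forall x, `|stop_weight k x * cond_exp k f x| <= M.
  by split; [exists (eta * lam)|exists lam] => x;
    have [->|[-> /cond_exp_stop[H1 H2]]] := stop_weight01 k x;
    rewrite ?mul1r// mul0r normr0 ?(ltW lam0)//; exact: mulr_ge0 eta0 (ltW lam0).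
have bw1 : bounded_level BB k.+1 (stop_weight k) by apply: (bounded_levelW filt) bw.
split.
  split=> [x y xy|]; first by rewrite /stopped (level_dif filt f xy) (bw1.1 _ _ xy).
  case: C1 C2 => M1 HM1 [M2 HM2]; exists (M1 + M2) => x.
  by rewrite /stopped /dif mulrBr (le_trans (ler_normB _ _))// lerD.
move=> A Ak.
have [i1 z1] := cond_exp_centred filt fi bw1 C1.
have [i2 z2] := cond_exp_centred filt fi bw C2.
have mA := ball_measurable filt (ex_intro2 _ _ k I Ak : balls BB A).
have := integralB mA (integrable_sub mA i1) (integrable_sub mA i2).
rewrite /= (z1 k)// (z2 k)// sube0 => <-.
apply: eq_integral => x _; rewrite -EFinB; congr (_%:E).
by rewrite /stopped /dif; ring.
Qed.

(** Up to the stopping level the increments telescope, and the last of them is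
    controlled by regularity. *)
Lemma stopped_bound n x : `|psum stopped n x| <= (1 + eta) * lam.
Proof.
have e0 : 0 <= (1 + eta) * lam := mulr_ge0 (addr_ge0 ler01 eta0) (ltW lam0).
have tele k : stop_weight k x = 1 ->
    psum stopped k x = cond_exp k f x - cond_exp 0 f x.
  move=> wk; have all j : (j <= k)%N -> stop_weight j x = 1.
    move=> jk; have [w0|[_ H]] := stop_weight01 k x.
      by move: wk; rewrite w0 => /eqP; rewrite eq_sym oner_eq0.
    by rewrite /stop_weight asboolT// => i ij; apply: H; exact: leq_trans jk.
  rewrite /psum; elim: k all {wk} => [|k IH] all; first by rewrite big_ord0 subrr.
  rewrite big_ord_recr/= IH; last by move=> j jk; apply: all; exact: ltnW.
  by rewrite /stopped all ?leqnSn// mul1r /dif addrC subrKA.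
elim: n => [|n IH]; first by rewrite /psum big_ord0 normr0.
have [w0|[w1 H]] := stop_weight01 n x.
  by rewrite /psum big_ord_recr/= -/(psum _ _ _) {2}/stopped w0 mul0r addr0.
rewrite /psum big_ord_recr/= -/(psum _ _ _) tele// /stopped w1 mul1r /dif.
rewrite addrC subrKA.
have [_ H1] := cond_exp_stop H.
have [|H0 _] := @cond_exp_stop 0 x; first by move=> j j0; apply: H; exact: leq_trans j0 _.
by rewrite (le_trans (ler_normB _ _))// mulrDl mul1r addrC lerD.
Qed.

Definition unstopped : set X := [set x | exists k, lam < cond_exp k (absf f) x].

Lemma stop_weight1 k x : ~ unstopped x -> stop_weight k x = 1.
Proof.
move=> nU; rewrite /stop_weight asboolT// => j _; rewrite leNgt; apply/negP => lt.
by apply: nU; exists j.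
Qed.

Lemma unstopped_measurable : measurable unstopped.
Proof.
have -> : unstopped = \bigcup_k (cond_exp k (absf f)) @^-1` [set y | lam < y].
  by apply/seteqP; split=> [x [k H]|x [k _ H]]; exists k.
apply: bigcup_measurable => k _.
exact: level_preimage filt _ _ _ _ (level_cond_exp filt (absf f)).
Qed.

(** Doob's maximal inequality: the stopping balls are disjoint. *)
Lemma doob_maximal : (lam%:E * mu unstopped <= \int[mu]_x `|f x|%:E)%E.
Proof.
pose P A := lam < avg mu (EFin \o absf f) A.
pose Q := first_balls BB P 0 setT.
have Qb : Q `<=` balls BB by move=> A; exact: first_balls_ball.
have Qt : trivIset Q id by exact: (first_balls_triv filt).
have UE : unstopped = \bigcup_(A in Q) A.
  apply/seteqP; split=> [x [k H]|x [A [_ [n [_ An PA _]]] Ax]].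
    apply: (first_balls_cover filt (P := P) _ _ (leq0n k) H) => //.
    by rewrite (filt0 filt).
  by exists n; rewrite /cond_exp (cell_eq filt An Ax).
have mU := unstopped_measurable.
rewrite -integral_cst//.
apply: (@le_trans _ _ (\int[mu]_(x in unstopped) `|f x|%:E)%E); last first.
  apply: ge0_subset_integral => //.
  exact: measurable_int integrable_absf.
rewrite UE; apply: (disjoint_balls_integral filt) => //.
- exact: measurable_int integrable_absf.
- by move=> x; rewrite lee_fin ltW.
- move=> A QA; have bA := Qb _ QA; have mA := ball_measurable filt bA.
  rewrite integral_const// -(avgE filt integrable_absf bA) lee_fin.
  rewrite ler_wpM2r ?fine_ge0//; case: QA => _ [n [_ _ PA _]]; exact: ltW.
Qed.

Variables (eps : set X -> R) (B : set X).
Hypothesis eps1 : forall A, balls BB A -> `|eps A| <= 1.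
Hypothesis mB : measurable B.
Hypothesis outB : forall x k, ~ B x -> dif k f x = 0.

Definition stopped_transform k x := eps (cell k x) * stopped k x.

Lemma mds_stopped_transform : mds mu BB stopped_transform.
Proof.
apply: (mds_weight filt mds_stopped (v := fun k x => eps (cell k x))) => k.
split=> [x y xy|]; first by rewrite (level_cell filt xy).
by exists 1 => x; apply: eps1; exact: cell_ball filt k x.
Qed.

Lemma stopped_energy n : \sum_(k < n) \int[mu]_x (stopped k x ^+ 2) <=
  ((1 + eta) * lam) ^+ 2 * m B.
Proof.
rewrite -(mds_energy filt n mds_stopped).
have e0 : 0 <= (1 + eta) * lam := mulr_ge0 (addr_ge0 ler01 eta0) (ltW lam0).
have bS := bounded_level_psum filt n mds_stopped.
have iS := bounded_level_integrable filt (bounded_levelM bS bS).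
have E : \int[mu]_x (psum stopped n x ^+ 2) = \int[mu]_(x in B) (psum stopped n x ^+ 2).
  rewrite [RHS]Rintegral_mkcond; apply: eq_Rintegral => x _.
  rewrite patchE; case: ifPn => // /negP nB.
  rewrite /psum big1 ?expr0n// => k _.
  by rewrite /stopped outB ?mulr0// => Bx; apply: nB; rewrite inE.
rewrite E -Rintegral_cst//; apply: le_Rintegral => //.
- exact: integrable_sub iS.
- apply: integrable_sub => //.
  exact: bounded_level_integrable filt _ _ (bounded_level_cst BB 0 _).
- move=> x _; rewrite -[leLHS]real_normK ?num_real//.
  by rewrite ler_pXn2r ?nnegrE// stopped_bound.
Qed.

Lemma stopped_transform_energy n :
  \sum_(k < n) \int[mu]_x (stopped_transform k x ^+ 2) <=
  ((1 + eta) * lam) ^+ 2 * m B.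
Proof.
apply: le_trans (stopped_energy n); apply: ler_sum => k _.
have [bS _] := mds_stopped k; have [bT _] := mds_stopped_transform k.
apply: le_Rintegral => //.
- exact: bounded_level_integrable filt _ _ (bounded_levelM bT bT).
- exact: bounded_level_integrable filt _ _ (bounded_levelM bS bS).
- move=> x _; rewrite /stopped_transform exprMn ler_piMl ?sqr_ge0//.
  by rewrite -[leLHS]real_normK ?num_real// expr_le1// eps1//; exact: (cell_ball filt).
Qed.

Lemma unstopped_transform n x : ~ unstopped x ->
  partial_transform mu BB eps n f x = psum stopped_transform n x.
Proof.
move=> nU; apply: eq_bigr => k _.
by rewrite /stopped_transform /stopped stop_weight1// mul1r.
Qed.

End fixed_function.

End stopped_transform.

(** * Convergence and weak type estimate of the transforms *)

Section transform_bounds.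
Context d (X : measurableType d) (R : realType).
Variable mu : {finite_measure set X -> \bar R}.
Variable BB : nat -> set (set X).
Hypothesis filt : filtration mu BB.
Variable eta : R.
Hypothesis eta1 : 1 <= eta.
Hypothesis reg : regular mu BB eta.
Local Notation m A := (fine (mu A)).
Local Notation dif := (dif mu BB).

(** Almost everywhere convergence: the transform agrees with a bounded one off
    a set that shrinks as the stopping height grows. *)
Lemma partial_transform_cvg (eps : set X -> R) f :
  (forall A, balls BB A -> `|eps A| <= 1) -> mu.-integrable setT (EFin \o f) ->
  mu.-negligible [set x | ~ cvgn (fun n => partial_transform mu BB eps n f x)].
Proof.
move=> eps1 fi.
pose h (i : nat) := stopped_transform mu BB f i.+1%:R eps.
pose U (i : nat) := unstopped mu BB f (i.+1%:R : R).
have lam0 (i : nat) : (0 : R) < i.+1%:R by [].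
have mU i : measurable (U i) by exact: (unstopped_measurable filt).
have N1 : mu.-negligible (\bigcup_i [set x | ~ cvgn (fun n => psum (h i) n x)]).
  apply: (@negligible_bigcup _ _ _ mu) => i.
  apply: (mds_cvg filt (V := ((1 + eta) * i.+1%:R) ^+ 2 * m setT)).
    exact: (mds_stopped_transform filt eta1 reg fi (lam0 i) eps1).
  move=> n.
  apply: (stopped_transform_energy filt eta1 reg fi (lam0 i) eps1 measurableT).
  by move=> x k; case.
have N2 : mu.-negligible (\bigcap_i U i).
  have mI : measurable (\bigcap_i U i) by exact: bigcap_measurable.
  exists (\bigcap_i U i); split=> //.
  pose I := \int[mu]_x `|f x|.
  have I0 : 0 <= I by apply: Rintegral_ge0 => x _.
  have fiI : (I%:E = \int[mu]_x `|f x|%:E)%E.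
    rewrite fineK//; apply: integrable_fin_num => //; exact: integrable_absf.
  apply: (@small_measure_eq0 _ _ _ mu _ 1) => // e e0.
  rewrite mul1e.
  pose i := Num.truncn (I / e).
  have lt : I / e < i.+1%:R by exact: truncnS_gt.
  apply: (@le_trans _ _ (mu (U i))).
    by apply: le_measure; rewrite ?inE//; exact: bigcap_inf.
  have := doob_maximal filt fi (lam0 i).
  rewrite -fiI -/(U i) => /(scaled_measure_le (mU i) (lam0 i)) H.
  rewrite -(finite_fineK mu (mU i)) lee_fin (le_trans H)//.
  by rewrite ler_pdivrMr// mulrC -ler_pdivrMr// ltW.
apply: (@negligibleS _ _ _ _ _ _ _ (negligibleU N1 N2)) => x /= ncv.
have [[i _ nU]|all] := pselect (exists2 i, True & ~ U i x).
  left; exists i => //= cv; apply: ncv.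
  rewrite (_ : (fun n => _) = fun n => psum (h i) n x)//.
  by apply/funext => n; exact: (unstopped_transform eps n nU).
by right => i _; apply: contrapT => nU; apply: all; exists i.
Qed.

(** Weak type estimate for the maximal transform and the square function at once.
    The first term of the bound is the set where stopping occurs, estimated by
    Doob's inequality; on the rest all increments are stopped ones, of energy at
    most [((1 + eta) * lam) ^+ 2 * m B]. *)
Lemma weak_estimate (eps : set X -> R) f B (lam t : R) :
  (forall A, balls BB A -> `|eps A| <= 1) -> mu.-integrable setT (EFin \o f) ->
  measurable B -> (forall x k, ~ B x -> dif k f x = 0) -> 0 < lam -> 0 < t ->
  exists E, [/\ measurable E,
    m E <= (\int[mu]_x `|f x|) / lam + 2 * (((1 + eta) * lam / t) ^+ 2 * m B) &
    forall x, ~ E x -> (forall n, `|partial_transform mu BB eps n f x| <= t) /\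
      (\sum_(0 <= k <oo) (dif k f x ^+ 2)%:E <= (t ^+ 2)%:E)%E].
Proof.
move=> eps1 fi mB outB lam0 t0.
set V := ((1 + eta) * lam) ^+ 2 * m B.
pose U := unstopped mu BB f lam.
pose h := stopped_transform mu BB f lam eps.
pose s := stopped mu BB f lam.
have hh : mds mu BB h := mds_stopped_transform filt eta1 reg fi lam0 eps1.
have hs : mds mu BB s := mds_stopped filt eta1 reg fi lam0.
pose EN := [set x | exists n, t < `|psum h n x|].
have bs k : bounded_level BB k.+1 (s k) by have [] := hs k.
have ms k : measurable_fun setT (fun x => (s k x ^+ 2)%:E).
  apply/measurable_EFinP.
  exact: (bounded_level_measurable filt (bounded_levelM (bs k) (bs k))).
pose G x := (\sum_(0 <= k <oo) (s k x ^+ 2)%:E)%E.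
have s0 k x : (0 <= (s k x ^+ 2)%:E)%E by rewrite lee_fin sqr_ge0.
have mG : measurable_fun setT G by apply: ge0_emeasurable_sum.
pose ES := [set x | ((t ^+ 2)%:E < G x)%E].
have mU : measurable U by exact: (unstopped_measurable filt).
have mEN : measurable EN by exact: (exceed_measurable filt).
have mES : measurable ES.
  by rewrite -[ES]setTI; apply: emeasurable_fun_o_infty.
have t20 : 0 < t ^+ 2 by rewrite exprn_gt0.
have HN : m EN <= V / t ^+ 2.
  apply: scaled_measure_le => //; apply: (kolmogorov filt hh t0) => n.
  exact: (stopped_transform_energy filt eta1 reg fi lam0 eps1 mB outB).
have HS : m ES <= V / t ^+ 2.
  apply: scaled_measure_le => //.
  apply: (@le_trans _ _ (\int[mu]_x G x)%E).
    apply: chebyshev_integral => //; first exact: ltW.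
      by move=> x; apply: nneseries_ge0.
    by move=> x /ltW.
  rewrite /G integral_nneseries//.
  apply: lime_le; first by apply: is_cvg_nneseries => k _ _; exact: integral_ge0.
  apply: nearW => n.
  have := stopped_energy filt eta1 reg fi lam0 mB outB n.
  rewrite -lee_fin; apply: le_trans; rewrite big_mkord -sumEFin.
  apply: lee_sum => k _; rewrite fineK//; apply: integrable_fin_num => //.
  exact: (bounded_level_integrable filt (bounded_levelM (bs k) (bs k))).
have HU : m U <= (\int[mu]_x `|f x|) / lam.
  apply: scaled_measure_le => //.
  rewrite fineK; first exact: (doob_maximal filt fi lam0).
  by apply: integrable_fin_num => //; exact: integrable_absf.
exists (U `|` (EN `|` ES)); split.
- by apply: measurableU => //; exact: measurableU.
- have -> : 2 * (((1 + eta) * lam / t) ^+ 2 * m B) = V / t ^+ 2 + V / t ^+ 2.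
    by rewrite /V; field; rewrite gt_eqF.
  have mNS : measurable (EN `|` ES) by exact: measurableU.
  apply: (le_trans (m_setU _ mU mNS)); apply: lerD => //.
  by apply: (le_trans (m_setU _ mEN mES)); exact: lerD.
- move=> x nE; have nU : ~ U x by move=> Ux; apply: nE; left.
  split.
    move=> n; rewrite (unstopped_transform eps n nU) leNgt.
    by apply/negP => lt; apply: nE; right; left; exists n.
  have -> : (\sum_(0 <= k <oo) (dif k f x ^+ 2)%:E)%E = G x.
    by apply: eq_eseriesr => k _; rewrite /s /stopped stop_weight1// mul1r.
  by rewrite leNgt; apply/negP => lt; apply: nE; right; right.
Qed.

End transform_bounds.

(** * Localisation on a ball *)

Section centring_on_balls.
Context d (X : measurableType d) (R : realType).
Variable mu : {finite_measure set X -> \bar R}.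
Variable BB : nat -> set (set X).
Hypothesis filt : filtration mu BB.
Local Notation cell := (cell BB).
Local Notation m A := (fine (mu A)).
Local Notation cond_exp := (cond_exp mu BB).
Local Notation dif := (dif mu BB).
Local Notation mtransn := (mtransn mu BB).
Local Notation partial_transform := (partial_transform mu BB).

Definition centred (f : X -> R) B x : R := (f x - avg mu (EFin \o f) B) * \1_B x.

Section centring.
Variables (f : X -> R) (B : set X).
Hypothesis fi : mu.-integrable setT (EFin \o f).
Hypothesis bB : balls BB B.
Local Notation g := (centred f B).
Local Notation c := (avg mu (EFin \o f) B).

Let mB : measurable B. Proof. exact: ball_measurable filt _ bB. Qed.

Lemma centredE : g = (fun x => f x - c) \_ B.
Proof.
apply/funext => x; rewrite /centred patchE indicE.
by case: (x \in B); rewrite ?mulr1 ?mulr0.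
Qed.

Lemma sub_cst_integrable D : measurable D ->
  mu.-integrable D (EFin \o (fun x => f x - c)).
Proof.
move=> mD.
exact: (integrableB mD (integrable_sub mD fi)
  (integrable_sub mD (bounded_level_integrable filt (bounded_level_cst BB 0 c)))).
Qed.

Lemma centred_integrable : mu.-integrable setT (EFin \o g).
Proof.
rewrite centredE -restrict_EFin.
by apply/(integrable_mkcond _ mB); exact: sub_cst_integrable.
Qed.

Lemma integral_sub_cst D : measurable D ->
  \int[mu]_(x in D) (f x - c) = \int[mu]_(x in D) f x - c * m D.
Proof.
move=> mD; rewrite RintegralB//; first by rewrite Rintegral_cst.
  exact: integrable_sub fi.
exact: (integrable_sub mD (bounded_level_integrable filt (bounded_level_cst BB 0 c))).
Qed.

Lemma avg_centred A : measurable A ->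
  avg mu (EFin \o g) A = (\int[mu]_(x in A `&` B) (f x - c)) / m A.
Proof.
move=> mA; rewrite /avg; congr (_ / _); rewrite centredE.
by rewrite Rintegral_mkcondr.
Qed.

Lemma avg_Rintegral A : balls BB A -> \int[mu]_(x in A) f x = avg mu (EFin \o f) A * m A.
Proof. by move=> bA; rewrite /avg divfK// gt_eqF// (m_gt0 filt bA). Qed.

Lemma cond_exp_centred0 k n x : BB k B -> ~ B x \/ (n <= k)%N -> cond_exp n g x = 0.
Proof.
move=> Bk H; rewrite /cond_exp avg_centred; last first.
  exact: ball_measurable filt _ (cell_ball filt n x).
set A := cell n x.
have AB0 : A `&` B = B \/ A `&` B = set0.
  have [[z [Az Bz]]|no] := pselect (A `&` B !=set0); last first.
    by right; apply/seteqP; split=> // z ABz; apply: no; exists z.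
  left; apply: setIidr.
  have [nk|kn] := leqP n k.
    exact: (ball_nested filt nk (cell_lev filt n x) Bk Az Bz).
  case: H => [nBx|nk]; last by move: kn; rewrite ltnNge nk.
  exfalso; apply: nBx.
  apply: (ball_nested filt (ltnW kn) Bk (cell_lev filt n x) Bz Az).
  exact: cell_self filt n x.
case: AB0 => ->; last by rewrite Rintegral_set0 mul0r.
by rewrite integral_sub_cst// avg_Rintegral// subrr mul0r.
Qed.

Lemma cond_exp_centred_in k n x : BB k B -> B x -> (k <= n)%N ->
  cond_exp n g x = cond_exp n f x - c.
Proof.
move=> Bk Bx kn; have bA := cell_ball filt n x.
have mA := ball_measurable filt bA.
rewrite /cond_exp avg_centred//.
have -> : cell n x `&` B = cell n x.
  apply: setIidl; exact: (ball_nested filt kn Bk (cell_lev filt n x) Bx (cell_self filt n x)).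
rewrite integral_sub_cst// avg_Rintegral// -mulrBl mulfK//.
by rewrite gt_eqF// (m_gt0 filt bA).
Qed.

Lemma dif_centred_out x k : ~ B x -> dif k g x = 0.
Proof.
move=> nB; case: bB => k0 _ Bk0.
by rewrite /dif !(cond_exp_centred0 Bk0) ?subrr//; left.
Qed.

Lemma dif_centred_lt k0 x k : BB k0 B -> (k < k0)%N -> dif k g x = 0.
Proof.
move=> Bk0 kk0.
by rewrite /dif !(cond_exp_centred0 Bk0) ?subrr//; right => //; exact: ltnW.
Qed.

Lemma dif_centred_ge k0 x k : BB k0 B -> B x -> (k0 <= k)%N -> dif k g x = dif k f x.
Proof.
move=> Bk0 Bx kk0; rewrite /dif !(cond_exp_centred_in Bk0)//; last exact: leqW.
by rewrite opprB addrA subrK.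
Qed.

(** On [B], the balls larger than [B] contribute a constant to the transform of
    [f] and nothing to that of the recentred function, and the smaller balls do
    not distinguish the two functions. The least level [k0] of [B] separates the
    two kinds; at [n = k0.-1] the constant has its final value already, while the
    recentred transform still vanishes. *)
Lemma mtransn_split eps : exists k0 (a : nat -> R), [/\
  forall x n, B x -> mtransn eps n f x = a n + mtransn eps n g x,
  forall x n, B x -> (n < k0)%N -> mtransn eps n g x = 0,
  forall n, (k0 <= n.+1)%N -> a n = a k0.-1 &
  k0 = 0%N -> forall n, a n = 0].
Proof.
have ex : exists k, `[< BB k B >] by case: bB => k _ Bk; exists k; apply/asboolP.
case: (ex_minnP ex) => k0 /asboolP Bk0 min.
have [y By] := ball_neq0 filt bB.
pose w n A := eps A * `[< upto BB n A >]%:R.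
have tail k x : B x -> cell (k0 + k) x `<=` B.
  move=> Bx; rewrite -(cell_eq filt Bk0 Bx); apply: (cell_sub filt); exact: leq_addr.
exists k0, (fun n => partial_transform (w n) k0 f y); split.
- move=> x n Bx; have [M HM] := mtransnE filt n x.
  rewrite !(HM (k0 + M)%N) ?leq_addl// /partial_transform !big_split_ord/= addrA.
  have E : cell k0 y x by rewrite (cell_eq filt Bk0 By).
  congr (_ + _).
    rewrite [X in _ + X]big1 ?addr0; last first.
      by move=> k _; rewrite (dif_centred_lt _ Bk0) ?mulr0.
    apply: eq_bigr => k _; rewrite (cell_congr filt (ltnW (ltn_ord k)) E).
    by rewrite (levelW filt (ltn_ord k) (level_dif filt f) E).
  by apply: eq_bigr => k _; rewrite (dif_centred_ge Bk0 Bx) ?leq_addr.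
- move=> x n Bx nk0; have [M HM] := mtransnE filt n x.
  rewrite (HM (k0 + M)%N) ?leq_addl// /partial_transform big_split_ord/=.
  rewrite big1 ?add0r; last by move=> k _; rewrite (dif_centred_lt _ Bk0) ?mulr0.
  rewrite big1// => k _; rewrite asboolF ?mulr0 ?mul0r//.
  case=> j /= jn Bj.
  have AB := tail k x Bx.
  have BA : B `<=` cell (k0 + k) x.
    have jk0 : (j <= k0)%N by rewrite (leq_trans jn)// ltnW.
    exact: (ball_nested filt jk0 Bj Bk0 (cell_self filt _ x) Bx).
  have E : cell (k0 + k) x = B by apply/seteqP; split.
  have := min j; rewrite -E => /(_ (introT (asboolP _) Bj)).
  by rewrite leqNgt (leq_ltn_trans jn nk0).
- move=> n kn; apply: eq_bigr => k _; congr (_ * _ * _).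
  rewrite !asboolT//; apply: (upto_le filt).
    by rewrite -ltnS prednK ?ltn_ord//; exact: leq_ltn_trans (ltn_ord k).
  by rewrite -ltnS (leq_trans (ltn_ord k)).
- by move=> -> n; rewrite /partial_transform big_ord0.
Qed.

End centring.
End centring_on_balls.

(** * Perturbation of suprema and limits *)

Section real_sequences.
Context (R : realType).
Implicit Types (v b c : nat -> R).

Local Notation esup v := (ereal_sup (range (fun n => (v n)%:E))).
Local Notation einf v := (ereal_inf (range (fun n => (v n)%:E))).

Lemma finite_max c k : exists2 n, (n <= k)%N & forall i, (i <= k)%N -> c i <= c n.
Proof.
elim: k => [|k [n nk max]]; first by exists 0%N => // i; rewrite leqn0 => /eqP ->.
have [le|lt] := leP (c k.+1) (c n).
  exists n; first exact: leqW.
  by move=> i; rewrite leq_eqVlt => /predU1P[->//|]; rewrite ltnS; exact: max.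
exists k.+1 => // i; rewrite leq_eqVlt => /predU1P[->//|]; rewrite ltnS => /max ic.
exact: le_trans ic (ltW lt).
Qed.

(** The supremum is close to the largest of the [c n] for [n < k0], which is
    attained by [v] there, where [b] vanishes. The number [C] is chosen before [v]
    and [b]: in the application these depend on a point of a ball, and [C] does
    not. *)
Lemma sup_split c k0 : (forall n, (k0 <= n.+1)%N -> c n = c k0.-1) ->
  exists C : R, forall v b, (forall n, v n <= c n + b n) ->
    (forall n, (n < k0)%N -> v n = c n /\ b n = 0) ->
    (k0 = 0%N -> forall n, v n = b n) ->
    (`|esup v - C%:E| <= `|esup b|)%E.
Proof.
case: k0 => [_|k cst].
  exists 0 => v b _ _ vb; rewrite sube0.
  by rewrite (_ : (fun n => (v n)%:E) = fun n => (b n)%:E)//; apply/funext => n; rewrite vb.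
have [n nk max] := finite_max c k.
exists (c n) => v b vcb v0 _.
have cn i : c i <= c n.
  have [/ltnW ik|ki] := ltnP i k; first exact: max.
  by rewrite cst//=; exact: max.
have b0 : (0 <= esup b)%E.
  by apply: ereal_sup_ubound; exists n => //; have [_ ->] := v0 n nk.
have lo : ((c n)%:E <= esup v)%E.
  by apply: ereal_sup_ubound; exists n => //; have [-> _] := v0 n nk.
rewrite (gee0_abs b0) gee0_abs ?sube_ge0// leeBlDr// addeC.
apply/ereal_supP => _ [i _ <-].
apply: (@le_trans _ _ ((c n)%:E + (b i)%:E)%E).
  by rewrite -EFinD lee_fin (le_trans (vcb i))// lerD2r.
by rewrite leeD2l//; apply: ereal_sup_ubound; exists i.
Qed.

Lemma inf_esupN v : einf v = (- esup (fun n => - v n))%E.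
Proof.
rewrite /ereal_inf; congr (- ereal_sup _)%E.
apply/seteqP; split=> [_ [_ [n _ <-] <-]|_ [n _ <-]]; first by exists n.
by exists (v n)%:E => //; exists n.
Qed.

Lemma limn_shift (u b : nat -> R) (C : R) k0 : cvgn u ->
  (forall n, (k0 <= n)%N -> u n = C + b n) ->
  (limn (fun n => (u n)%:E) - C%:E = limn (fun n => (b n)%:E))%E.
Proof.
move=> /cvg_ex[l ul] ub.
have bl : b @ \oo --> l - C.
  apply: (cvg_trans _ (cvgB ul (cvg_cst C))).
  apply: near_eq_cvg; exists k0 => // n /= kn.
  by rewrite -[LHS]/(u n - C) ub// addrC addKr.
have -> : limn (fun n => (u n)%:E) = l%:E.
  by apply: cvg_lim => //; exact: cvg_EFin (nearW _ _) ul.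
have -> : limn (fun n => (b n)%:E) = (l - C)%:E.
  by apply: cvg_lim => //; exact: cvg_EFin (nearW _ _) bl.
by rewrite -EFinB.
Qed.

Lemma sqrt_split (a : R) (s : \bar R) : 0 <= a -> (0 <= s)%E ->
  (`|(a%:E + s) `^ 2^-1 - (Num.sqrt a)%:E| <= s `^ 2^-1)%E.
Proof.
move=> a0; case: s => [s| |]// s0; last first.
  by rewrite addey// poweRyr ?gt_eqF ?invr_gt0.
rewrite lee_fin in s0.
rewrite -EFinD !poweR_EFin !powR12_sqrt ?addr_ge0//.
rewrite abse_EFin lee_fin.
have le : Num.sqrt a <= Num.sqrt (a + s) by rewrite ler_sqrt ?lerDl// addr_ge0.
rewrite ger0_norm ?subr_ge0// lerBlDr.
rewrite -(@ler_pXn2r _ 2)// ?nnegrE ?addr_ge0 ?sqrtr_ge0//.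
rewrite sqrrD !sqr_sqrtr ?addr_ge0// [a + s]addrC lerD2r lerDl mulrn_wge0//.
Qed.

Lemma abse_le (x : \bar R) (t : R) : ((- t)%:E <= x)%E -> (x <= t%:E)%E ->
  (`|x| <= t%:E)%E.
Proof.
by case: x => [y||]//=; rewrite !lee_fin ler_norml => -> ->.
Qed.

End real_sequences.

(** * Measurability and domination of the operators *)

Section martingale_operators.
Context d (X : measurableType d) (R : realType).
Variable mu : {finite_measure set X -> \bar R}.
Variable BB : nat -> set (set X).
Hypothesis filt : filtration mu BB.
Local Notation level := (level BB).
Local Notation dif := (dif mu BB).
Local Notation mtransn := (mtransn mu BB).
Local Notation partial_transform := (partial_transform mu BB).

Lemma level_partial_transform eps n f : level n (partial_transform eps n f).
Proof.
move=> x y xy; apply: eq_bigr => k _.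
rewrite (cell_congr filt (ltnW (ltn_ord k)) xy).
by rewrite (levelW filt (ltn_ord k) (level_dif filt f) xy).
Qed.

Lemma mtransn_measurable eps n f : measurable_fun setT (mtransn eps n f).
Proof.
apply: (@measurable_fun_cvg _ _ _ _ (fun M =>
  partial_transform (fun A => eps A * `[< upto BB n A >]%:R) M f)).
  move=> M; exact: level_measurable filt _ _ _ _ (level_partial_transform _ _).
move=> x _; have [M HM] := mtransnE filt n x.
by apply: cvg_near_cst; exists M => // i /= Mi; rewrite -(HM _ Mi).
Qed.

(** The limit is the upper limit where it coincides with the lower one, and the
    default value [0] elsewhere. *)
Lemma limn_measurable (u : nat -> X -> \bar R) : (forall n, measurable_fun setT (u n)) ->
  measurable_fun setT (fun x => limn (u ^~ x)).
Proof.
move=> mu'.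
pose U x := limn_esup (u ^~ x); pose L x := limn_einf (u ^~ x).
have mU : measurable_fun setT U by exact: measurable_fun_limn_esup.
have mL : measurable_fun setT L.
  have -> : L = (fun x => - limn_esup (fun n => - u n x))%E.
    apply/funext => x; rewrite -[in RHS]limn_einfN; congr limn_einf.
    by apply/funext => n /=; rewrite oppeK.
  apply: measurableT_comp => //.
  by apply: measurable_fun_limn_esup => n; exact: measurableT_comp.
(* If both limits are infinite and equal, their difference is [-oo]. *)
pose D := [set x | (U x - L x <= 0)%E].
have mD : measurable D.
  by rewrite -[D]setTI; apply: emeasurable_fun_infty_c => //; exact: emeasurable_funB.
have -> : (fun x => limn (u ^~ x)) = U \_ D; last first.
  by apply/(measurable_restrictT _ mD); exact: measurable_funTS.
apply/funext => x; rewrite patchE.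
have LU : (L x <= U x)%E by exact: limn_einf_sup.
case: ifPn => [|/negP nD].
  rewrite inE /D/= leNgt sube_gt0 -leNgt => UL.
  have E : L x = U x by apply/eqP; rewrite eq_le LU.
  apply: cvg_lim => //; apply: (@squeeze_cvge _ _ _ _ (einfs (u ^~ x)) _ (esups (u ^~ x))).
  - apply: nearW => n; apply/andP; split.
      by apply: ereal_inf_lbound; exists n => //=.
    by apply: ereal_sup_ubound; exists n => //=.
  - by rewrite -E /L limn_einf_lim; exact: is_cvg_einfs.
  - by rewrite /U limn_esup_lim; exact: is_cvg_esups.
apply: dvgP => /cvg_ex[l ul]; apply: nD; rewrite inE /D/= leNgt sube_gt0 -leNgt.
by have [El Es] := cvg_limn_einf_sup ul; rewrite /U /L El Es.
Qed.

Lemma square_function_measurable f : measurable_fun setT (square_function mu BB f).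
Proof.
rewrite (_ : square_function mu BB f =
  fun x => (\sum_(0 <= k <oo) (dif k f x ^+ 2)%:E) `^ 2^-1)%E; last first.
  by apply/funext => x; rewrite (square_functionE filt).
apply: (measurableT_comp (measurable_poweR _)).
apply: ge0_emeasurable_sum => // [k x _ _|k _]; first by rewrite lee_fin sqr_ge0.
apply/measurable_EFinP; apply: measurable_funX.
exact: level_measurable filt _ _ _ _ (level_dif filt f).
Qed.

Lemma operator_measurable eps T f : martingale_operator mu BB eps T ->
  measurable_fun setT (T f).
Proof.
have mt n : measurable_fun setT (fun x => (mtransn eps n f x)%:E).
  by apply/measurable_EFinP; exact: mtransn_measurable.
case=> [|n||||].
- exact: limn_measurable.
- exact: mt.
- rewrite (_ : mtrans_star _ _ _ _ = fun x => esups (fun n => `|(mtransn eps n f x)%:E|)%E 0).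
    by apply: measurable_fun_esups => n; exact: measurableT_comp.
  apply/funext => x; rewrite /mtrans_star /esups; congr ereal_sup.
  by apply/seteqP; split=> _ [n _ <-]; exists n.
- rewrite (_ : mtrans_plus _ _ _ _ = fun x => esups (fun n => (mtransn eps n f x)%:E) 0).
    by apply: measurable_fun_esups.
  apply/funext => x; rewrite /mtrans_plus /esups; congr ereal_sup.
  by apply/seteqP; split=> _ [n _ <-]; exists n.
- rewrite (_ : mtrans_minus _ _ _ _ = fun x => einfs (fun n => (mtransn eps n f x)%:E) 0).
    by apply: measurable_fun_einfs.
  apply/funext => x; rewrite /mtrans_minus /einfs; congr ereal_inf.
  by apply/seteqP; split=> _ [n _ <-]; exists n.
- exact: square_function_measurable.
Qed.

(** This includes the points where the transforms diverge, as the limit then has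
    the default value [0]. *)
Lemma operator_dominated eps T f x (t : R) : martingale_operator mu BB eps T ->
  0 <= t -> (forall n, `|partial_transform eps n f x| <= t) ->
  (\sum_(0 <= k <oo) (dif k f x ^+ 2)%:E <= (t ^+ 2)%:E)%E ->
  (`|T f x| <= t%:E)%E.
Proof.
move=> opT t0 Ht Hs.
have H n : `|mtransn eps n f x| <= t.
  by have [k _ ->] := mtransn_partial filt n x eps f.
have Hp n : ((mtransn eps n f x)%:E <= t%:E)%E.
  by rewrite lee_fin; apply: le_trans (H n); exact: ler_norm.
have Hm n : ((- t)%:E <= (mtransn eps n f x)%:E)%E.
  by rewrite lee_fin; have := H n; rewrite ler_norml => /andP[].
case: opT => [|n||||].
- have [cv|ncv] := pselect (cvgn (fun n => (mtransn eps n f x)%:E)).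
    rewrite /mtrans; apply: abse_le.
      by apply: lime_ge => //; apply: nearW.
    by apply: lime_le => //; apply: nearW.
  by rewrite /mtrans (dvgP ncv) abse0 lee_fin.
- by rewrite abse_EFin lee_fin.
- rewrite gee0_abs; last by apply: le_ereal_sup_tmp; exists `|mtransn eps 0 f x|%:E; [exists 0%N|rewrite lee_fin].
  by apply/ereal_supP => _ [n _ <-]; rewrite lee_fin.
- apply: abse_le.
    by apply: le_ereal_sup_tmp; exists (mtransn eps 0 f x)%:E => //; exists 0%N.
  by apply/ereal_supP => _ [n _ <-].
- apply: abse_le.
    by apply: le_ereal_inf_tmp => _ [n _ <-].
  by apply: ge_ereal_inf; exists (mtransn eps 0 f x)%:E => //; exists 0%N.
- rewrite gee0_abs; last by rewrite poweR_ge0.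
  rewrite (square_functionE filt).
  apply: (@le_trans _ _ ((t ^+ 2)%:E `^ 2^-1)%E).
    apply: gt0_ler_poweR => //; rewrite ?invr_ge0// in_itv/= ?leey ?andbT ?lee_fin ?sqr_ge0//.
    by apply: nneseries_ge0 => k _ _; rewrite lee_fin sqr_ge0.
  by rewrite poweR_EFin powR12_sqrt ?sqr_ge0// sqrtr_sqr ger0_norm.
Qed.

End martingale_operators.

(** * Localisation of the operators *)

Section operator_splitting.
Context d (X : measurableType d) (R : realType).
Variable mu : {finite_measure set X -> \bar R}.
Variable BB : nat -> set (set X).
Hypothesis filt : filtration mu BB.
Variable eta : R.
Hypothesis eta1 : 1 <= eta.
Hypothesis reg : regular mu BB eta.
Local Notation dif := (dif mu BB).
Local Notation mtransn := (mtransn mu BB).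
Local Notation partial_transform := (partial_transform mu BB).

Lemma mtransn_cvg eps f x : cvgn (fun n => partial_transform eps n f x) ->
  cvgn (fun n => mtransn eps n f x).
Proof.
move=> /cvg_ex[l pl]; apply/cvg_ex; exists l; apply/cvgrPdist_lt => e e0.
have /cvgrPdist_lt/(_ e e0)[M _ HM] := pl.
exists M => // n /= Mn; have [k nk ->] := mtransn_partial filt n x eps f.
by apply: HM => /=; exact: leq_trans nk.
Qed.

(** On a ball [B], all the operators applied to [f] differ from a constant by at
    most their value at [f] recentred on [B]. For the pointwise limit this needs
    convergence almost everywhere. *)
Lemma operator_split eps T f B : (forall A, balls BB A -> `|eps A| <= 1) ->
  martingale_operator mu BB eps T -> mu.-integrable setT (EFin \o f) ->
  balls BB B -> exists C : R, exists2 N, mu.-negligible N &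
    forall x, B x -> ~ N x -> (`|T f x - C%:E| <= `|T (centred mu f B) x|)%E.
Proof.
move=> eps1 opT fi bB.
have [k0 [a [split before after a0]]] := mtransn_split filt fi bB eps.
set g := centred mu f B in split before *.
have N0 : mu.-negligible set0 by exact: negligible_set0.
case: opT => [|n||||].
- exists (a k0.-1); exists [set x | ~ cvgn (fun n => partial_transform eps n f x)].
    exact: (partial_transform_cvg filt eta1 reg).
  move=> x Bx /= /contrapT /mtransn_cvg cv.
  rewrite /mtrans (@limn_shift _ _ (fun n => mtransn eps n g x) _ k0)// => n kn.
  by rewrite split// after// ltnW.
- exists (a n); exists set0 => // x Bx _.
  by rewrite split// -EFinB addrC addKr.
- have [C HC] := @sup_split R (fun n => `|a n|) k0 (fun n kn => congr1 Num.norm (after n kn)).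
  exists C; exists set0 => // x Bx _.
  apply: (HC (fun n => `|mtransn eps n f x|) (fun n => `|mtransn eps n g x|)).
  + by move=> n; rewrite split//; exact: ler_normD.
  + by move=> n nk; rewrite split// before// addr0 normr0.
  + by move=> k00 n; rewrite split// a0// add0r.
- have [C HC] := @sup_split R a k0 after.
  exists C; exists set0 => // x Bx _.
  apply: (HC (fun n => mtransn eps n f x) (fun n => mtransn eps n g x)).
  + by move=> n; rewrite split.
  + by move=> n nk; rewrite split// before// addr0.
  + by move=> k00 n; rewrite split// a0// add0r.
- have [C HC] := @sup_split R (fun n => - a n) k0 (fun n kn => congr1 -%R (after n kn)).
  exists (- C); exists set0 => // x Bx _.
  rewrite /mtrans_minus !inf_esupN EFinN oppeK abseN.
  rewrite -abseN fin_num_oppeD// oppeK.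
  apply: (HC (fun n => - mtransn eps n f x) (fun n => - mtransn eps n g x)).
  + by move=> n; rewrite split// opprD.
  + by move=> n nk; rewrite split// before// addr0 oppr0.
  + by move=> k00 n; rewrite split// a0// add0r.
- have [k _ Bk] := bB; have [y By] := ball_neq0 filt bB.
  exists (Num.sqrt (\sum_(0 <= i < k) dif i f y ^+ 2)); exists set0 => // x Bx _.
  rewrite !(square_functionE filt) [leRHS]gee0_abs ?poweR_ge0//.
  have sq0 h j : (0 <= (dif j h x ^+ 2)%:E)%E by rewrite lee_fin sqr_ge0.
  rewrite (_ : (\sum_(0 <= i <oo) (dif i f x ^+ 2)%:E)%E =
    ((\sum_(0 <= i < k) dif i f y ^+ 2)%:E +
     \sum_(0 <= i <oo) (dif i g x ^+ 2)%:E)%E).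
    apply: sqrt_split; first by apply: sumr_ge0 => i _; exact: sqr_ge0.
    by apply: nneseries_ge0.
  rewrite (nneseries_split 0 k)// [in RHS](nneseries_split 0 k)// !add0n.
  have -> : (\sum_(0 <= i < k) (dif i g x ^+ 2)%:E = 0)%E.
    rewrite big_nat_cond big1// => i /andP[/andP[_ ik] _].
    by rewrite (dif_centred_lt filt fi bB _ Bk) ?expr0n.
  rewrite add0e.
  congr (_ + _)%E.
    rewrite -sumEFin; apply: eq_big_nat => i /andP[_ ik].
    have E : cell BB k y x by rewrite (cell_eq filt Bk By).
    by rewrite (levelW filt ik (level_dif filt f) E).
  rewrite [LHS]eseries_cond [RHS]eseries_cond.
  apply: eq_eseriesr => i /andP[_ ki].
  by rewrite (dif_centred_ge filt fi Bk Bx).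
Qed.

End operator_splitting.

(** * Density of the sets of finite level *)

Section density.
Context d (X : measurableType d) (R : realType).
Variable mu : {finite_measure set X -> \bar R}.
Variable BB : nat -> set (set X).
Hypothesis filt : filtration mu BB.
Local Notation cell := (cell BB).
Local Notation level := (level BB).
Local Notation m A := (fine (mu A)).

Definition approximable (A : set X) := measurable A /\ forall e : R, 0 < e ->
  exists n (G : set X), level n G /\ m (A `\` G) + m (G `\` A) <= e.

Let mlev n (G : set X) : level n G -> measurable G.
Proof.
move=> lG; have -> : G = G @^-1` [set P | P] by [].
exact: level_preimage filt _ _ _ _ lG.
Qed.

Lemma approximableU A B : approximable A -> approximable B -> approximable (A `|` B).
Proof.
move=> [mA aA] [mB aB]; split; first exact: measurableU.
move=> e e0; have e20 : 0 < e / 2 by rewrite divr_gt0.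
have [n1 [G1 [l1 d1]]] := aA _ e20; have [n2 [G2 [l2 d2]]] := aB _ e20.
have mG1 := mlev l1; have mG2 := mlev l2.
exists (maxn n1 n2), (G1 `|` G2); split.
  move=> x y xy.
  have E1 := levelW filt (leq_maxl n1 n2) l1 xy.
  have E2 := levelW filt (leq_maxr n1 n2) l2 xy.
  by rewrite -[LHS]/(G1 y \/ G2 y) E1 E2.
have H1 : m ((A `|` B) `\` (G1 `|` G2)) <= m (A `\` G1) + m (B `\` G2).
  apply: le_trans (m_setU _ _ _); try exact: measurableD.
  apply: m_le.
  - by apply: measurableD; exact: measurableU.
  - by apply: measurableU; exact: measurableD.
  - by move=> x [[Ax|Bx] nG]; [left|right]; split=> // Gx; apply: nG; [left|right].
have H2 : m ((G1 `|` G2) `\` (A `|` B)) <= m (G1 `\` A) + m (G2 `\` B).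
  apply: le_trans (m_setU _ _ _); try exact: measurableD.
  apply: m_le.
  - by apply: measurableD; exact: measurableU.
  - by apply: measurableU; exact: measurableD.
  - by move=> x [[Ax|Bx] nG]; [left|right]; split=> // Gx; apply: nG; [left|right].
lra.
Qed.

(** The approximable sets form a sigma-algebra that contains the balls. *)
Lemma measurable_approximable A : measurable A -> approximable A.
Proof.
have a0 : approximable set0.
  split=> // e e0; exists 0%N, set0; split=> //.
  by rewrite setD0 measure0/= addr0 ltW.
rewrite (filt_generate filt); apply: smallest_sub; last first.
  move=> B bB; split; first exact: ball_measurable filt _ bB.
  move=> e e0; case: bB => n _ Bn; exists n, B; split; last first.
    by rewrite setDv measure0/= addr0 ltW.
  move=> x y xy; apply/propext; split=> [By|Bx].
    rewrite -(cell_eq filt Bn By) (level_cell filt xy); exact: cell_self filt n x.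
  rewrite -(cell_eq filt Bn Bx); exact: xy.
split=> // {A}.
- move=> A [mA aA]; rewrite setTD; split; first exact: measurableC.
  move=> e /aA[n [G [lG dG]]]; exists n, (~` G); split.
    by move=> x y xy; rewrite -[LHS]/(~ G y) (lG _ _ xy).
  have DC (U V : set X) : ~` U `\` ~` V = V `\` U by rewrite setDE setCK setIC -setDE.
  by rewrite !DC addrC.
- move=> A aA.
  have mA i : measurable (A i) by have [] := aA i.
  pose F n := \big[setU/set0]_(i < n) A i.
  have aF n : approximable (F n).
    rewrite /F; elim: n => [|n IH]; first by rewrite big_ord0.
    by rewrite big_ord_recr/=; exact: approximableU.
  have mF n : measurable (F n) by have [] := aF n.
  have mU : measurable (\bigcup_i A i) by exact: bigcup_measurable.
  have FU n : F n `<=` \bigcup_i A i.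
    by rewrite /F -bigcup_mkord => x [i _ Ax]; exists i.
  split=> // e e0; have e20 : 0 < e / 2 by rewrite divr_gt0.
  have [n Hn] : exists n, m (\bigcup_i A i) - m (F n) <= e / 2.
    have UE : \bigcup_i A i = \bigcup_n F n.
      apply/seteqP; split=> [x [i _ Ax]|x [n _ /FU//]].
      exists i.+1 => //; rewrite /F -bigcup_mkord; exists i => //=.
    have cv : mu \o F @ \oo --> mu (\bigcup_i A i).
      rewrite UE; apply: nondecreasing_cvg_mu => //; first by rewrite -UE.
      move=> a b ab; apply/subsetPset; rewrite /F -!bigcup_mkord => x [i /= ia Ax].
      by exists i => //=; exact: leq_trans ab.
    have cvr : (fun n => m (F n)) @ \oo --> m (\bigcup_i A i).
      by apply: fine_cvg; rewrite finite_fineK.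
    have /cvgrPdist_lt/(_ _ e20)[n _ H] := cvr.
    exists n; have := H n (leqnn n) => /=.
    by move=> /ltW; apply: le_trans; exact: ler_norm.
  have [_ /(_ _ e20)[k [G [lG dG]]]] := aF n.
  have mG := mlev lG.
  exists k, G; split=> //.
  have H1 : m (\bigcup_i A i `\` G) <= m (\bigcup_i A i `\` F n) + m (F n `\` G).
    apply: le_trans (m_setU _ _ _); try exact: measurableD.
    apply: m_le; [exact: measurableD|by apply: measurableU; exact: measurableD|].
    move=> x [Ax nG]; have [Fx|nF] := pselect (F n x); [by right|by left].
  have H2 : m (G `\` \bigcup_i A i) <= m (G `\` F n).
    apply: m_le; try exact: measurableD.
    by move=> x [Gx nA]; split=> // /FU.
  have H3 := m_setD mu mU (mF n) (FU n).
  lra.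
Qed.

(** A weak form of the density theorem: a set of finite level close to [Z] is a
    union of balls, so that at least half of it lies outside [Z]. *)
Lemma half_density (Z : set X) : measurable Z ->
  (forall A, balls BB A -> m (Z `&` A) <= m A / 2) -> mu Z = 0.
Proof.
move=> mZ H; apply: (@small_measure_eq0 _ _ _ mu _ 1) => // e e0; rewrite mul1e.
have [_ aZ] := measurable_approximable mZ.
have e40 : 0 < e / 4 by rewrite divr_gt0.
have [n [G [lG dG]]] := aZ _ e40; have mG := mlev lG.
pose Q := [set A | BB n A /\ A `<=` G].
have GE : G = \bigcup_(A in Q) A.
  apply/seteqP; split=> [x Gx|x [A [_ AG] /AG//]].
  exists (cell n x); last exact: cell_self filt n x.
  by split; [exact: cell_lev filt n x|move=> y xy; rewrite (lG x y xy)].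
have QB : Q `<=` balls BB by move=> A [An _]; exists n.
have tQ : trivIset Q id.
  apply: (sub_trivIset (D' := BB n)); first by move=> A [].
  by case: (filt_partition filt n).
have HG : m (Z `&` G) <= m G / 2.
  have : (\int[mu]_(x in G) (\1_Z x)%:E <= \int[mu]_(x in G) (2^-1)%:E)%E.
    rewrite GE; apply: (disjoint_balls_integral filt) => //.
    - by apply/measurable_EFinP; exact: measurable_indic.
    - move=> A [An AG]; have bA : balls BB A by exists n.
      have mA := ball_measurable filt bA.
      rewrite integral_indicE// integral_const//.
      by rewrite lee_fin mulrC; exact: H.
  rewrite integral_indicE// integral_const//.
  by rewrite lee_fin mulrC.
rewrite -(finite_fineK mu mZ) lee_fin.
have H1 : m Z <= m (Z `&` G) + m (Z `\` G).
  apply: le_trans (m_setU _ _ _); [|exact: measurableI|exact: measurableD].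
  by rewrite setUIDK.
have H2 : m G <= m Z + m (G `\` Z).
  apply: le_trans (m_setU _ _ _) => //; last exact: measurableD.
  apply: m_le => //; first by apply: measurableU => //; exact: measurableD.
  by move=> x Gx; have [Zx|nZ] := pselect (Z x); [left|right].
have : 0 <= m (Z `\` G) by exact: fine_ge0.
have : 0 <= m (G `\` Z) by exact: fine_ge0.
lra.
Qed.

End density.

(** * Truncation *)

Section truncation.
Context (R : realType).

(** Truncated moments are finite from the start, which allows to absorb them. *)
Definition cap (M : R) (y : \bar R) : R := fine (Order.min y M%:E).

Lemma cap_EFin (M y : R) : cap M y%:E = Num.min y M.
Proof. by rewrite /cap -EFin_min. Qed.

Lemma cap_pinfty (M : R) : cap M +oo = M.
Proof. by rewrite /cap minye. Qed.

Lemma cap_le (M t : R) (y : \bar R) : (y <= t%:E)%E -> (0 <= y)%E ->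
  cap M y <= t.
Proof.
by case: y => [y||]//; rewrite !lee_fin cap_EFin ge_min => ->.
Qed.

Lemma cap_leM (M : R) (y : \bar R) : (0 <= y)%E -> cap M y <= M.
Proof.
case: y => [y _||]; rewrite ?cap_pinfty ?leeNy_eq//.
by rewrite cap_EFin ge_min lexx orbT.
Qed.

Lemma cap_ge0 (M : R) (y : \bar R) : 0 <= M -> (0 <= y)%E -> 0 <= cap M y.
Proof.
move=> M0; case: y => [y y0||]; rewrite ?cap_pinfty ?leeNy_eq//.
by rewrite cap_EFin le_min -lee_fin y0.
Qed.

Lemma cap_shift (M t : R) (y z : \bar R) : 0 <= t -> (0 <= y)%E -> (0 <= z)%E ->
  (y <= t%:E + z)%E -> cap M y <= t + cap M z.
Proof.
move=> t0; case: y => [y||]//; case: z => [z||]// y0 z0;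
  rewrite ?cap_EFin ?cap_pinfty.
- rewrite -EFinD lee_fin => yz.
  by rewrite /Order.min; case: ifP; case: ifP; lra.
- by move=> _; rewrite ge_min; apply/orP; right; rewrite lerDr.
- by move=> _; rewrite lerDr.
Qed.

Lemma cap_mono (M N : R) (y : \bar R) : M <= N -> (0 <= y)%E -> cap M y <= cap N y.
Proof.
move=> MN; case: y => [y||]// y0; rewrite ?cap_EFin ?cap_pinfty//.
by rewrite le_min !ge_min lexx MN orbT.
Qed.

Lemma powRD_le (x y p : R) : 0 <= p -> 0 <= x -> 0 <= y ->
  (x + y) `^ p <= 2 `^ p * (x `^ p + y `^ p).
Proof.
move=> p0 x0 y0; wlog xy : x y x0 y0 / x <= y.
  move=> H; have [|/ltW] := leP x y; first exact: H.
  by move=> yx; rewrite addrC [X in _ * X]addrC; exact: H.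
apply: (@le_trans _ _ ((2 * y) `^ p)).
  apply: ge0_ler_powR => //; rewrite ?nnegrE ?addr_ge0 ?mulr_ge0//; lra.
by rewrite powRM// ler_wpM2l ?powR_ge0// lerDr powR_ge0.
Qed.

End truncation.
(** * The John-Nirenberg argument *)

Section john_nirenberg.
Context d (X : measurableType d) (R : realType).
Variable mu : {finite_measure set X -> \bar R}.
Variable BB : nat -> set (set X).
Hypothesis filt : filtration mu BB.
Variable eta : R.
Hypothesis reg : regular mu BB eta.
Local Notation cell := (cell BB).
Local Notation m A := (fine (mu A)).

Variables (F : X -> \bar R) (c : set X -> R) (alpha lam p : R).
Hypothesis mF : measurable_fun setT F.
Hypothesis p1 : 1 <= p.
Hypothesis lam0 : 0 < lam.
Hypothesis alpha0 : 0 < alpha.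
Hypothesis alpha_eta : alpha * (1 + eta) < 1.
Hypothesis alpha8 : alpha < 8^-1.
Hypothesis alphap : 2 `^ p * (2 * alpha) <= 2^-1.

Definition dist B x : \bar R := `|F x - (c B)%:E|%E.
Definition far B : set X := [set x | (lam%:E < dist B x)%E].

Hypothesis Hfar : forall B, balls BB B -> m (far B `&` B) <= alpha * m B.

Let p0 : 0 <= p. Proof. exact: le_trans ler01 p1. Qed.

Lemma dist_ge0 B x : (0 <= dist B x)%E. Proof. exact: abse_ge0. Qed.

Lemma dist_measurable B : measurable_fun setT (dist B).
Proof.
apply: measurableT_comp => //; apply: emeasurable_funB => //.
Qed.

Lemma far_measurable B : measurable (far B).
Proof.
rewrite -[far B]setTI; apply: emeasurable_fun_o_infty => //.
exact: dist_measurable.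
Qed.

Lemma cap_dist_measurable M B : measurable_fun setT (fun x => (cap M (dist B x) `^ p)%:E).
Proof.
apply/measurable_EFinP.
apply: (measurableT_comp (measurable_powR _)).
apply: (measurableT_comp (fine_measurable measurableT)).
by apply: measurable_mine => //; exact: dist_measurable.
Qed.

Lemma meets_complement (A S1 S2 : set X) : measurable A -> measurable S1 ->
  measurable S2 -> m S1 + m S2 < m A -> exists x, [/\ A x, ~ S1 x & ~ S2 x].
Proof.
move=> mA m1 m2 lt; apply: contrapT => no.
have : m A <= m (S1 `|` S2).
  apply: m_le => //; first exact: measurableU.
  move=> x Ax; apply: contrapT => nS; apply: no; exists x; split=> // Sx; apply: nS;
    by [left|right].
by have := m_setU mu m1 m2; lra.
Qed.

Lemma dist_close A B x : ~ far A x -> ~ far B x -> `|c A - c B| <= 2 * lam.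
Proof.
rewrite /far /dist/= => /negP; rewrite -leNgt => hA /negP; rewrite -leNgt => hB.
case: (F x) hA hB => [y||]//; rewrite -!EFinB !abse_EFin !lee_fin => hA hB.
have -> : c A - c B = (y - c B) - (y - c A) by lra.
by rewrite (le_trans (ler_normB _ _))//; lra.
Qed.

(** Calderon-Zygmund step. Off the largest balls [Q] that [far B] fills by more
    than half, almost every point is close to [c B]; these balls have small total
    measure, and by regularity [c Q] is still within [4 * lam] of [c B]. *)
Lemma moment_step (M I : R) : 0 <= M -> 0 <= I ->
  (forall B, balls BB B ->
     \int[mu]_(x in B) (cap M (dist B x) `^ p)%:E <= (I * m B)%:E)%E ->
  forall B, balls BB B ->
    (\int[mu]_(x in B) (cap M (dist B x) `^ p)%:E <=
      ((lam `^ p + (4 * lam) `^ p / 2 + I / 2) * m B)%:E)%E.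
Proof.
move=> M0 I0 HI B bB; have [k _ Bk] := bB.
have mB := ball_measurable filt bB.
pose G := far B `&` B.
have mG : measurable G by apply: measurableI => //; exact: far_measurable.
have HG : m G <= alpha * m B by exact: Hfar.
have aS A : balls BB A -> alpha * m A <= 8^-1 * m A.
  by move=> bA; rewrite ler_wpM2r ?fine_ge0// ltW.
pose P Q := m Q / 2 < m (G `&` Q).
pose QQ := first_balls BB P k B.
have Qb : QQ `<=` balls BB by move=> A; exact: first_balls_ball.
have Qt : trivIset QQ id by exact: (first_balls_triv filt).
pose U := \bigcup_(Q in QQ) Q.
have mU : measurable U by exact: (disjoint_balls_measurable filt).
have UB : U `<=` B by move=> x [Q [QB _] /QB].
have B0 := m_gt0 filt bB.
have HU : m U <= 2 * alpha * m B.
  have : (\int[mu]_(x in U) (2^-1)%:E <= \int[mu]_(x in U) (\1_G x)%:E)%E.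
    apply: (disjoint_balls_integral filt) => //.
    - by apply/measurable_EFinP; exact: measurable_indic.
    - move=> Q QQ'; have bQ := Qb _ QQ'; have mQ := ball_measurable filt bQ.
      rewrite integral_indicE// integral_const// lee_fin mulrC ltW//.
      by case: QQ' => _ [n [_ _ PQ _]].
  rewrite integral_indicE// integral_const// lee_fin => H.
  have : m (G `&` U) <= m G by apply: m_le => //; exact: measurableI.
  by nra.
have notP A : ~ P A -> m (G `&` A) <= m A / 2.
  by rewrite /P => /negP; rewrite -leNgt.
(* Almost every point of [far B] lies in one of the balls [Q]. *)
have Z0 : mu (G `\` U) = 0.
  apply: (half_density filt); first exact: measurableD.
  move=> A bA; have mA := ball_measurable filt bA; have [n _ An] := bA.
  have A0 := m_gt0 filt bA.
  have mGU : measurable ((G `\` U) `&` A) by apply: measurableI => //; exact: measurableD.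
  have [[z [[[Gz Bz] nUz] Az]]|no] := pselect ((G `\` U) `&` A !=set0); last first.
    have -> : (G `\` U) `&` A = set0.
      by apply/seteqP; split=> // z H; apply: no; exists z.
    by rewrite measure0/=; lra.
  have [kn|nk] := leqP k n.
    have AB : A `<=` B by exact: (ball_nested filt kn Bk An Bz Az).
    have nP : ~ P A.
      move=> PA; apply: nUz; apply: (first_balls_cover filt Bk Bz kn).
      by rewrite (cell_eq filt An Az).
    apply: le_trans (notP A nP).
    by apply: m_le => //; [exact: measurableI|move=> x [[]]].
  have BA : B `<=` A by exact: (ball_nested filt (ltnW nk) An Bk Az Bz).
  have BAm : m B <= m A by exact: m_le.
  have : m ((G `\` U) `&` A) <= m G by apply: m_le => // x [[]].
  by have := aS _ bB; lra.
(* Both constants are compared with that of the parent [A] of [Q]: the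
   exceptional sets of [Q] and [A] do not cover [Q], by regularity, nor do those of
   [A] and [B] cover [A], as [far B] fills at most half of it. *)
have close Q : QQ Q -> `|c B - c Q| <= 4 * lam.
  move=> QQ'; have bQ := Qb _ QQ'; have mQ := ball_measurable filt bQ.
  have Q0 := m_gt0 filt bQ.
  case: QQ' => QB [n [kn Qn PQ min]].
  have [x Qx] := ball_neq0 filt bQ.
  have kn' : (k < n)%N.
    rewrite ltn_neqAle kn andbT; apply/eqP => E.
    have EQ : Q = B by rewrite -(cell_eq filt Bk (QB _ Qx)) E (cell_eq filt Qn Qx).
    move: PQ; rewrite /P EQ.
    have : m (G `&` B) <= m G by apply: m_le => //; exact: measurableI.
    by have := aS _ bB; lra.
  case: n kn' Qn PQ min {kn} => // n; rewrite ltnS => kn Qn PQ min.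
  pose A := cell n x.
  have An : BB n A by exact: cell_lev filt n x.
  have bA : balls BB A by exists n.
  have mA := ball_measurable filt bA; have A0 := m_gt0 filt bA.
  have Ax : A x by exact: cell_self filt n x.
  have QA : Q `<=` A by exact: (ball_nested filt (leqnSn n) An Qn Ax Qx).
  have AB : A `<=` B by exact: (ball_nested filt kn Bk An (QB _ Qx) Ax).
  have nP : ~ P A by apply: (min n A) => //; rewrite kn leqnn.
  have GA := notP A nP.
  have rg := reg An Qn QA.
  have fA := Hfar bA; have fQ := Hfar bQ.
  have mfA : measurable (far A `&` A) by apply: measurableI => //; exact: far_measurable.
  have mfQ : measurable (far Q `&` Q) by apply: measurableI => //; exact: far_measurable.
  have [y1 [Qy1 n1 n1']] : exists x, [/\ Q x, ~ (far Q `&` Q) x & ~ (far A `&` A) x].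
    apply: meets_complement => //.
    have h1 : alpha * m A <= alpha * (eta * m Q) by rewrite ler_wpM2l// ltW.
    have h2 : alpha * (1 + eta) * m Q < m Q by rewrite gtr_pMl.
    lra.
  have [y2 [Ay2 n2 n2']] : exists x, [/\ A x, ~ (G `&` A) x & ~ (far A `&` A) x].
    apply: meets_complement => //; first exact: measurableI.
    by have := aS _ bA; lra.
  have d1 : `|c A - c Q| <= 2 * lam.
    apply: (@dist_close A Q y1) => [fa|fq].
      by apply: n1'; split=> //; exact: QA.
    by apply: n1.
  have d2 : `|c B - c A| <= 2 * lam.
    apply: (@dist_close B A y2) => [fb|fa].
      by apply: n2; split=> //; split=> //; exact: AB.
    by apply: n2'.
  have -> : c B - c Q = (c B - c A) + (c A - c Q) by lra.
  by rewrite (le_trans (ler_normD _ _))//; lra.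
pose uB x := (cap M (dist B x) `^ p)%:E.
have muB : measurable_fun setT uB by exact: cap_dist_measurable.
have uB0 x : (0 <= uB x)%E by rewrite lee_fin powR_ge0.
have u0 A x : 0 <= cap M (dist A x) by apply: cap_ge0 => //; exact: dist_ge0.
pose K := 2 `^ p * ((4 * lam) `^ p + I).
have K0 : 0 <= K by rewrite mulr_ge0 ?powR_ge0// addr_ge0 ?powR_ge0.
have intU : (\int[mu]_(x in U) uB x <= (K * m U)%:E)%E.
  rewrite -integral_const//; apply: (disjoint_balls_integral filt) => //.
  move=> Q QQ'; have bQ := Qb _ QQ'; have mQ := ball_measurable filt bQ.
  apply: (@le_trans _ _ (\int[mu]_(x in Q) ((2 `^ p)%:E * (((4 * lam) `^ p)%:E + (cap M (dist Q x) `^ p)%:E)))%E).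
    apply: ge0_le_integral => //; first exact: measurable_funTS.
      apply: measurable_funTS; apply: emeasurable_funM => //.
      by apply: emeasurable_funD => //; exact: cap_dist_measurable.
    move=> x _; rewrite /uB -EFinD -EFinM lee_fin.
    apply: le_trans (powRD_le p0 _ (u0 Q x)); last by rewrite mulr_ge0// ltW.
    apply: ge0_ler_powR => //; rewrite ?nnegrE ?addr_ge0 ?mulr_ge0 ?(ltW lam0)//.
    apply: cap_shift; rewrite ?dist_ge0 ?mulr_ge0 ?(ltW lam0)//.
    have cl := close Q QQ'.
    rewrite /dist; case: (F x) => [y||]//.
    rewrite -!EFinB !abse_EFin -EFinD lee_fin.
    have -> : y - c B = (y - c Q) - (c B - c Q) by lra.
    by rewrite (le_trans (ler_normB _ _))//; lra.
  have mq : measurable_fun Q (fun x => (cap M (dist Q x) `^ p)%:E).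
    by apply: measurable_funTS; exact: cap_dist_measurable.
  rewrite ge0_integralZl_EFin ?powR_ge0//; last 2 first.
  - by move=> x _; rewrite adde_ge0// lee_fin powR_ge0.
  - by apply: emeasurable_funD.
  rewrite ge0_integralD//; last 2 first.
  - by move=> x _; rewrite lee_fin powR_ge0.
  - by move=> x _; rewrite lee_fin powR_ge0.
  have KE : ((K * m Q)%:E =
      (2 `^ p)%:E * (((4 * lam) `^ p * m Q)%:E + (I * m Q)%:E))%E.
    by rewrite -EFinD -EFinM /K; congr (_%:E); ring.
  rewrite !integral_const// KE; apply: lee_wpmul2l; first by rewrite lee_fin powR_ge0.
  by rewrite leeD2l//; exact: HI.
have intR : (\int[mu]_(x in B `\` U) uB x <= (lam `^ p * m B)%:E)%E.
  have mBU : measurable (B `\` U) by exact: measurableD.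
  have mGU : measurable (G `\` U) by exact: measurableD.
  rewrite (@ge0_negligible_integral _ _ _ mu _ (G `\` U))//; last exact: measurable_funTS.
  have mD : measurable ((B `\` U) `\` (G `\` U)) by exact: measurableD.
  apply: (@le_trans _ _ (\int[mu]_(x in (B `\` U) `\` (G `\` U)) (lam `^ p)%:E)%E).
    apply: ge0_le_integral => //; first exact: measurable_funTS.
    move=> x [[Bx nU] nG]; rewrite lee_fin; apply: ge0_ler_powR => //;
      rewrite ?nnegrE ?(ltW lam0)//.
    apply: cap_le; last exact: dist_ge0.
    rewrite leNgt; apply/negP => fx; apply: nG; split=> //.
  rewrite integral_const// lee_fin ler_wpM2l ?powR_ge0//.
  by apply: m_le => // x [[]].
have intB : (\int[mu]_(x in B) uB x =
    \int[mu]_(x in U) uB x + \int[mu]_(x in B `\` U) uB x)%E.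
  have mBU : measurable (B `\` U) by exact: measurableD.
  rewrite -[in LHS](setDUK UB) ge0_integral_setU//; first exact: measurable_funTS.
  by apply/disj_setPS; rewrite setDIK.
rewrite intB; apply: (le_trans (leeD intU intR)); rewrite -EFinD lee_fin.
have : K * m U <= K * (2 * alpha * m B) by rewrite ler_wpM2l.
have -> : K * (2 * alpha * m B) = (2 `^ p * (2 * alpha)) * (((4 * lam) `^ p + I) * m B).
  by rewrite /K; ring.
have : (2 `^ p * (2 * alpha)) * (((4 * lam) `^ p + I) * m B) <=
    2^-1 * (((4 * lam) `^ p + I) * m B).
  by rewrite ler_wpM2r// mulr_ge0 ?(ltW B0)// addr_ge0 ?powR_ge0.
rewrite !mulrDl; lra.
Qed.

Let a := lam `^ p + (4 * lam) `^ p / 2.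

Let a0 : 0 <= a.
Proof. by rewrite addr_ge0 ?powR_ge0// divr_ge0// powR_ge0. Qed.

(** Starting from the trivial bound [M `^ p], each step halves the excess over the
    fixed point [2 * a]. *)
Lemma cap_dist_moment (M : R) : 0 <= M -> forall B, balls BB B ->
  (\int[mu]_(x in B) (cap M (dist B x) `^ p)%:E <= (2 * a * m B)%:E)%E.
Proof.
move=> M0 B bB.
have iter n A : balls BB A -> (\int[mu]_(x in A) (cap M (dist A x) `^ p)%:E <=
    ((2 * a + M `^ p / 2 ^+ n) * m A)%:E)%E.
  elim: n A => [|n IH] A bA.
    have mA := ball_measurable filt bA.
    apply: (@le_trans _ _ ((M `^ p * m A)%:E)).
      rewrite -integral_const//; apply: ge0_le_integral => //.
      - by move=> x _; rewrite lee_fin powR_ge0.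
      - by apply: measurable_funTS; exact: cap_dist_measurable.
      - move=> x _; rewrite lee_fin; apply: ge0_ler_powR => //.
        + by rewrite nnegrE cap_ge0// dist_ge0.
        + by apply: cap_leM; exact: dist_ge0.
    by rewrite expr0 divr1 lee_fin ler_wpM2r ?fine_ge0// lerDr mulr_ge0.
  apply: (le_trans (moment_step M0 _ IH bA)).
    by rewrite addr_ge0 ?mulr_ge0 ?divr_ge0 ?powR_ge0 ?exprn_ge0.
  rewrite lee_fin ler_wpM2r ?fine_ge0// exprS invfM -/a.
  by rewrite le_eqVlt; apply/orP; left; apply/eqP; field; rewrite expf_neq0.
apply/lee_addgt0Pr => e e0.
have mB0 : 0 <= M `^ p * m B by rewrite mulr_ge0 ?powR_ge0// fine_ge0.
pose n := Num.truncn (M `^ p * m B / e).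
have lt : M `^ p * m B / e < n.+1%:R by exact: truncnS_gt.
apply: (le_trans (iter n B bB)); rewrite -EFinD lee_fin mulrDl lerD2l.
rewrite mulrAC ler_pdivrMr ?exprn_gt0// [leRHS]mulrC -ler_pdivrMr//.
rewrite (le_trans (ltW lt))// -natrX ler_nat; exact: ltn_expl.
Qed.

(** Monotone convergence removes the truncation. *)
Lemma dist_moment B : balls BB B ->
  (\int[mu]_(x in B) (dist B x `^ p) <= ((2 + 4 `^ p) * lam `^ p * m B)%:E)%E.
Proof.
move=> bB; have mB := ball_measurable filt bB.
pose v n x := (cap n%:R (dist B x) `^ p)%:E.
have mv n : measurable_fun B (v n).
  by apply: measurable_funTS; exact: cap_dist_measurable.
have v0 n x : B x -> (0 <= v n x)%E by rewrite lee_fin powR_ge0.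
have ndv x : B x -> {homo v ^~ x : a b / (a <= b)%N >-> (a <= b)%E}.
  move=> _ i j ij; rewrite lee_fin; apply: ge0_ler_powR => //.
  - by rewrite nnegrE cap_ge0// dist_ge0.
  - by rewrite nnegrE cap_ge0// dist_ge0.
  - by apply: cap_mono; [rewrite ler_nat|exact: dist_ge0].
have E x : B x -> (dist B x `^ p)%E = limn (v ^~ x).
  move=> _; apply/esym/cvg_lim => //; rewrite /v.
  have := dist_ge0 B x; case: (dist B x) => [y||]; rewrite ?leeNy_eq// => y0.
    apply: cvg_near_cst; exists (Num.truncn y).+1 => // i /= yi.
    rewrite cap_EFin min_l//.
    by rewrite (le_trans (ltW (truncnS_gt y)))// ler_nat.
  rewrite poweRyr; last by rewrite gt_eqF// (lt_le_trans ltr01 p1).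
  apply/cvgeyPge => A; exists (Num.truncn A).+1 => // i /= Ai.
  rewrite cap_pinfty lee_fin (le_trans (ltW (truncnS_gt A)))//.
  apply: (@le_trans _ _ i%:R); first by rewrite ler_nat.
  rewrite -[leLHS]powRr1//; apply: ler_powR => //.
  by rewrite ler1n; exact: leq_trans Ai.
rewrite (eq_integral (fun x => limn (v ^~ x))); last by move=> x /set_mem/E.
rewrite monotone_convergence//; apply: lime_le.
  by apply: ereal_nondecreasing_is_cvgn => i j ij; apply: ge0_le_integral => // x Bx;
    [exact: v0|exact: ndv].
apply: nearW => n; apply: (le_trans (cap_dist_moment _ bB)) => //.
rewrite lee_fin ler_wpM2r ?fine_ge0// /a powRM ?(ltW lam0)//.
by rewrite le_eqVlt; apply/orP; left; apply/eqP; field.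
Qed.

End john_nirenberg.

(** * Means of order r *)

Section means.
Context d (X : measurableType d) (R : realType).
Variable mu : {finite_measure set X -> \bar R}.
Variable BB : nat -> set (set X).
Hypothesis filt : filtration mu BB.
Local Notation m A := (fine (mu A)).
Variable r : R.
Hypothesis r1 : 1 < r.

Let r0 : 0 < r. Proof. exact: lt_trans ltr01 r1. Qed.

Lemma poweRK (x : \bar R) : (0 <= x)%E -> ((x `^ r^-1) `^ r = x)%E.
Proof. by move=> x0; rewrite -poweRrM mulVf ?gt_eqF// poweRe1. Qed.

Lemma le_poweR (q : R) (x y : \bar R) : 0 <= q -> (0 <= x)%E -> (x <= y)%E ->
  (x `^ q <= y `^ q)%E.
Proof.
move=> q0 x0 xy; apply: gt0_ler_poweR => //; rewrite in_itv/= leey andbT//.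
exact: le_trans xy.
Qed.

Lemma integral_powR_ge0 (F : X -> \bar R) B : (0 <= \int[mu]_(x in B) (`|F x| `^ r))%E.
Proof. by apply: integral_ge0 => x _; exact: poweR_ge0. Qed.

Lemma mean_leP (F : X -> \bar R) B (s : R) : balls BB B -> 0 <= s ->
  (mean mu r F B <= s%:E)%E <->
  (\int[mu]_(x in B) (`|F x| `^ r) <= (s `^ r * m B)%:E)%E.
Proof.
move=> bB s0; rewrite /mean; set I := (\int[mu]_(x in B) _)%E.
have I0 : (0 <= I)%E := integral_powR_ge0 F B.
have B0 := m_gt0 filt bB.
have c0 : (0 <= (m B)^-1%:E)%E by rewrite lee_fin invr_ge0 ltW.
have cI0 : (0 <= (m B)^-1%:E * I)%E by exact: mule_ge0.
have mulE (z : \bar R) : (z = (m B)%:E * ((m B)^-1%:E * z))%E.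
  by rewrite muleA -EFinM divff ?gt_eqF// mul1e.
split=> H.
  have := le_poweR (ltW r0) (poweR_ge0 _ _) H.
  rewrite poweRK// poweR_EFin => H'; rewrite (mulE I) mulrC EFinM.
  by apply: lee_wpmul2l => //; rewrite lee_fin ltW.
rewrite -(_ : ((s `^ r)%:E `^ r^-1)%E = s%:E); last first.
  by rewrite poweR_EFin -powRrM divff ?gt_eqF// powRr1.
apply: le_poweR => //; first by rewrite invr_ge0 ltW.
rewrite (_ : (s `^ r)%:E = (m B)^-1%:E * (s `^ r * m B)%:E)%E.
  exact: lee_wpmul2l.
by rewrite -EFinM; congr (_%:E); field; rewrite gt_eqF.
Qed.

(** A bound on the [r]-th moment bounds the first one, as [y <= 1 + y ^ r]. *)
Lemma first_moment_le (h : X -> \bar R) B (K s : R) : measurable B ->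
  measurable_fun B h -> (forall x, 0 <= h x)%E -> 0 < s -> 0 <= K ->
  (\int[mu]_(x in B) (h x `^ r) <= (K * s `^ r * m B)%:E)%E ->
  (\int[mu]_(x in B) h x <= ((1 + K) * s * m B)%:E)%E.
Proof.
move=> mB mh h0 s0 K0 H.
have sr0 : 0 < s `^ r by exact: powR_gt0.
have mhr : measurable_fun B (fun x => (h x `^ r)%E).
  exact: (measurableT_comp (measurable_poweR _)).
apply: (@le_trans _ _ (\int[mu]_(x in B) (s%:E + (s / s `^ r)%:E * (h x `^ r)))%E).
  apply: ge0_le_integral => //.
    by apply: emeasurable_funD => //; exact: emeasurable_funM.
  move=> x _; have := h0 x; case: (h x) => [y||]; rewrite ?leeNy_eq//; last first.
    by move=> _; rewrite poweRyr ?gt_eqF// gt0_muley ?lte_fin ?divr_gt0// addey.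
  rewrite lee_fin => y0; rewrite poweR_EFin -EFinM -EFinD lee_fin.
  have [ys|sy] := leP y s.
    by rewrite (le_trans ys)// lerDl mulr_ge0 ?powR_ge0// divr_ge0 ?powR_ge0// ltW.
  have y1 : y / s <= (y / s) `^ r.
    rewrite -[leLHS]powRr1 ?divr_ge0 ?(ltW s0)//.
    by rewrite ler_powR ?(ltW r1)// ler_pdivlMr// mul1r ltW.
  have yE : s / s `^ r * y `^ r = s * (y / s) `^ r.
    have -> : y `^ r = (y / s) `^ r * s `^ r.
      by rewrite -powRM ?divr_ge0 ?(ltW s0)// divfK// gt_eqF.
    by field; rewrite gt_eqF.
  rewrite yE; apply: (@le_trans _ _ (s * (y / s))); first by rewrite mulrC divfK// gt_eqF.
  by apply: (@le_trans _ _ (s * (y / s) `^ r)); [rewrite ler_pM2l|rewrite lerDr ltW].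
rewrite ge0_integralD//; last 3 first.
- by move=> x _; rewrite lee_fin ltW.
- by move=> x _; rewrite mule_ge0 ?poweR_ge0// lee_fin divr_ge0 ?(ltW s0)// ltW.
- exact: emeasurable_funM.
rewrite ge0_integralZl_EFin//; last 2 first.
- by move=> x _; exact: poweR_ge0.
- exact: divr_ge0 (ltW s0) (ltW sr0).
rewrite integral_const//.
have sE : ((1 + K) * s * m B)%:E =
    ((s * m B)%:E + (s / s `^ r)%:E * (K * s `^ r * m B)%:E)%E.
  by rewrite -EFinM -EFinD; congr (_%:E); field; rewrite gt_eqF.
rewrite sE leeD2l//; apply: lee_wpmul2l => //.
by rewrite lee_fin (divr_ge0 (ltW s0) (ltW sr0)).
Qed.

Lemma poweRD_le (x : \bar R) (y : R) : (0 <= x)%E -> 0 <= y ->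
  ((x + y%:E) `^ r <= (2 `^ r)%:E * (x `^ r + (y `^ r)%:E))%E.
Proof.
case: x => [x||]; rewrite ?leeNy_eq// => x0 y0.
  by rewrite -EFinD !poweR_EFin -EFinD -EFinM lee_fin powRD_le// ltW.
by rewrite !poweRyr ?gt_eqF// addye// gt0_muley ?leey// lte_fin powR_gt0.
Qed.

End means.

(** * The oscillation inequality *)

Section oscillation.
Context d (X : measurableType d) (R : realType).
Variable mu : {finite_measure set X -> \bar R}.
Variable BB : nat -> set (set X).
Hypothesis filt : filtration mu BB.
Variable eta : R.
Hypothesis eta1 : 1 <= eta.
Hypothesis reg : regular mu BB eta.
Variable r : R.
Hypothesis r1 : 1 < r.
Local Notation m A := (fine (mu A)).
Local Notation dif := (dif mu BB).
Local Notation partial_transform := (partial_transform mu BB).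
Local Notation centred := (centred mu).

Let r0 : 0 < r. Proof. exact: lt_trans ltr01 r1. Qed.

Variables (eps : set X -> R) (T : (X -> R) -> X -> \bar R).
Hypothesis eps1 : forall A, balls BB A -> `|eps A| <= 1.
Hypothesis opT : martingale_operator mu BB eps T.

Lemma exceed_set_measurable f (t : R) : measurable [set x | (t%:E < `|T f x|)%E].
Proof.
rewrite -[X in measurable X]setTI; apply: emeasurable_fun_o_infty => //.
apply: measurableT_comp => //; exact: (operator_measurable filt f opT).
Qed.

Lemma negligible_cover N : mu.-negligible N ->
  exists N', [/\ measurable N', m N' = 0 & N `<=` N'].
Proof. by case=> N' [mN' N'0 sub]; exists N'; split=> //; rewrite N'0. Qed.

(** Where the operator at the recentred function is at most [t], the values of
    [T f] lie within [t] of a constant. *)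
Lemma osc_beta_le f B (beta t : R) : mu.-integrable setT (EFin \o f) ->
  balls BB B -> 0 < t ->
  m [set x | (t%:E < `|T (centred f B) x|)%E] < (1 - beta) * m B ->
  (osc_beta mu B beta (T f) <= (2 * t)%:E)%E.
Proof.
move=> fi bB t0 Hm; have mB := ball_measurable filt bB.
have [C [N nN HN]] := operator_split filt eta1 reg eps1 opT fi bB.
have [N' [mN' N'0 NN']] := negligible_cover nN.
set S := [set x | _] in Hm.
have mS : measurable S by exact: exceed_set_measurable.
have mSN : measurable (S `|` N') by exact: measurableU.
pose E := B `\` (S `|` N').
have mE : measurable E by exact: measurableD.
apply: (@le_trans _ _ (osc mu E (T f))).
  apply: ereal_inf_lbound; exists E => //; split=> //; first by move=> x [].
  rewrite -(finite_fineK mu mB) -(finite_fineK mu mE) -EFinM lte_fin.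
  have : m B <= m E + (m S + m N').
    apply: (@le_trans _ _ (m (E `|` (S `|` N')))).
      apply: m_le => //; first exact: measurableU.
      by move=> x Bx; have [SN|nSN] := pselect ((S `|` N') x); [right|left].
    by apply: (le_trans (m_setU _ _ _)) => //; rewrite lerD2l; exact: m_setU.
  by lra.
have H x : E x -> (`|T f x - C%:E| <= t%:E)%E.
  move=> [Bx nSN]; apply: (@le_trans _ _ (`|T (centred f B) x|)%E).
    by apply: HN => // Nx; apply: nSN; right; exact: NN'.
  by rewrite leNgt; apply/negP => lt; apply: nSN; left.
apply/ess_supP; apply: aeW => -[x y] /=; rewrite patchE.
case: ifPn => [|_]; last by rewrite lee_fin mulr_ge0// ltW.
rewrite inE => -[/= /H Hx /H Hy].
case: (T f x) Hx => [u||]//; case: (T f y) Hy => [v||]//.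
rewrite -!EFinB !abse_EFin !lee_fin => Hv Hu.
have -> : u - v = (u - C) - (v - C) by lra.
by rewrite (le_trans (ler_normB _ _))//; lra.
Qed.

Section lebesgue_class.
Variables (f : X -> R) (B : set X).
Hypothesis fr : f \in Lfun mu r%:E.
Hypothesis bB : balls BB B.
Local Notation g := (centred f B).
Local Notation c := (avg mu (EFin \o f) B).

Let mB : measurable B. Proof. exact: ball_measurable filt _ bB. Qed.

Lemma Lfun_fun_measurable : measurable_fun setT f.
Proof. by move: fr; rewrite inE => /andP[/[!inE]/=]. Qed.

Lemma Lfun_EFin_integrable : mu.-integrable setT (EFin \o f).
Proof.
apply/Lfun1_integrable; move: fr; apply: Lfun_subset => //.
- by rewrite lee_fin ltW.
- exact: fin_num_measure.
- by rewrite lee_fin ltW.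
Qed.

Lemma centred_moment : (\int[mu]_x (`|(g x)%:E| `^ r) =
  \int[mu]_(x in B) (`|(EFin \o f) x - c%:E| `^ r))%E.
Proof.
rewrite [RHS]integral_mkcond; apply: eq_integral => x _.
rewrite patchE /centred indicE; case: (x \in B); first by rewrite mulr1.
by rewrite mulr0 abse0 poweR0r// gt_eqF.
Qed.

Lemma centred_moment_lty :
  (\int[mu]_(x in B) (`|(EFin \o f) x - c%:E| `^ r) < +oo)%E.
Proof.
have mf := Lfun_fun_measurable.
have mfr : measurable_fun setT (fun x => (`|(f x)%:E| `^ r)%E).
  apply: (measurableT_comp (measurable_poweR _)).
  by apply: measurableT_comp => //; exact/measurable_EFinP.
apply: (@le_lt_trans _ _ (\int[mu]_(x in B) ((2 `^ r)%:E *
    (`|(f x)%:E| `^ r + (`|c| `^ r)%:E)))%E).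
  apply: ge0_le_integral => //.
  - by move=> x _; exact: poweR_ge0.
  - apply: (measurableT_comp (measurable_poweR _)).
    apply: measurableT_comp => //; apply: measurable_funTS.
    by apply/measurable_EFinP; exact: measurable_funB.
  - apply: emeasurable_funM => //; apply: emeasurable_funD => //.
    exact: measurable_funTS.
  - move=> x _; apply: le_trans (poweRD_le r1 _ _) => //.
    apply: le_poweR (ltW r0) _ _ => //.
    by rewrite -EFinB !abse_EFin -EFinD lee_fin ler_normB.
rewrite ge0_integralZl_EFin ?powR_ge0//; last 2 first.
- by move=> x _; rewrite adde_ge0 ?poweR_ge0// lee_fin powR_ge0.
- by apply: emeasurable_funD => //; exact: measurable_funTS.
rewrite ge0_integralD//; last 2 first.
- by move=> x _; exact: poweR_ge0.
- exact: measurable_funTS.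
rewrite integral_const//; apply: lte_mul_pinfty; rewrite ?lee_fin ?powR_ge0//.
rewrite lte_add_pinfty ?ltry//.
have := Lfun_integrable (ltW r1) fr => /integrableP[_].
apply: le_lt_trans; apply: (@le_trans _ _ (\int[mu]_x (`|(f x)%:E| `^ r))%E).
  by apply: ge0_subset_integral => // x _; exact: poweR_ge0.
rewrite le_eqVlt; apply/orP; left; apply/eqP/eq_integral => x _.
by rewrite [RHS]gee0_abs ?lee_fin ?powR_ge0.
Qed.

Lemma centred_Lfun : g \in Lfun mu r%:E.
Proof.
have fi := Lfun_EFin_integrable.
rewrite inE; apply/andP; split; rewrite inE/=.
  by apply/measurable_EFinP; exact: measurable_int (centred_integrable filt fi bB).
rewrite /finite_norm unlock /Lnorm; apply: poweR_lty.
have := centred_moment; rewrite /= => ->; exact: centred_moment_lty.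
Qed.

Lemma sharp_fin_num : sharp mu r (EFin \o f) B \is a fin_num.
Proof.
rewrite ge0_fin_numE; last exact: poweR_ge0.
rewrite /sharp /mean; apply: poweR_lty; apply: lte_mul_pinfty => //.
- by rewrite lee_fin invr_ge0 fine_ge0.
- exact: centred_moment_lty.
Qed.

Lemma Lnorm_centred : ('N[mu]_r%:E[EFin \o g] =
  (fine (sharp mu r (EFin \o f) B) * m B `^ r^-1)%:E)%E.
Proof.
have B0 := m_gt0 filt bB.
rewrite EFinM fineK ?sharp_fin_num// unlock /Lnorm.
have := centred_moment; rewrite /= => ->.
rewrite -poweR_EFin -poweRM//; last 2 first.
- by apply: mule_ge0; [rewrite lee_fin invr_ge0 ltW|exact: integral_powR_ge0].
- by rewrite lee_fin ltW.
by rewrite muleAC -EFinM mulVf ?gt_eqF// mul1e.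
Qed.

(** The weak type bound at the recentred function, at the height where it leaves
    a share [1 - beta] of [B]. *)
Lemma osc_beta_weak (beta K e : R) : 0 < beta -> beta < 1 -> 0 <= K -> 0 < e ->
  (forall h : X -> R, h \in Lfun mu r%:E ->
     (weak_norm mu r (T h) <= K%:E * 'N[mu]_r%:E [EFin \o h])%E) ->
  (osc_beta mu B beta (T f) <=
   (2 * ((1 - beta) `^ (- r^-1) * K * fine (sharp mu r (EFin \o f) B) + e))%:E)%E.
Proof.
move=> beta0 beta1 K0 e0 HK.
set sig := fine _; set t := (_ + e).
have sig0 : 0 <= sig by rewrite fine_ge0// poweR_ge0.
have B0 := m_gt0 filt bB.
have b0 : 0 < 1 - beta by rewrite subr_gt0.
have q0 : 0 < (1 - beta) `^ r^-1 by exact: powR_gt0.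
have t0 : 0 < t.
  by rewrite ltr_wpDl// !mulr_ge0// powR_ge0.
apply: (osc_beta_le Lfun_EFin_integrable bB t0).
have mS := exceed_set_measurable g t; set S := [set x | _] in mS *.
rewrite ltNge; apply/negP => le.
have : (t%:E * mu S `^ r^-1 <= K%:E * (sig * m B `^ r^-1)%:E)%E.
  rewrite -Lnorm_centred; apply: le_trans (HK g centred_Lfun).
  by apply: ereal_sup_ubound; exists t.
rewrite -(finite_fineK mu mS) poweR_EFin -!EFinM lee_fin => H.
have H2 : ((1 - beta) * m B) `^ r^-1 <= m S `^ r^-1.
  apply: ge0_ler_powR => //; rewrite ?nnegrE ?invr_ge0 ?(ltW r0) ?fine_ge0//.
  by rewrite mulr_ge0 ?fine_ge0// ltW.
have Bp : 0 < m B `^ r^-1 by exact: powR_gt0.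
have H3 : t * ((1 - beta) `^ r^-1 * m B `^ r^-1) <= K * sig * m B `^ r^-1.
  rewrite -powRM ?fine_ge0 ?(ltW b0)// -mulrA; apply: le_trans H.
  by rewrite ler_wpM2l// ltW.
have H4 : t * (1 - beta) `^ r^-1 <= K * sig by rewrite -(ler_pM2r Bp) -mulrA.
move: H4; rewrite /t powRN mulrDl.
have -> : ((1 - beta) `^ r^-1)^-1 * K * sig * (1 - beta) `^ r^-1 = K * sig.
  by field; rewrite gt_eqF.
by rewrite gerDl leNgt mulr_gt0.
Qed.

(** When the norm of [T] is infinite, the right-hand side of the oscillation
    inequality is [+oo * 0 = 0] for functions that are constant on [B]; the
    operators vanish at the recentred function then. *)
Lemma osc_beta_sharp0 (beta : R) : 0 < beta -> beta < 1 ->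
  fine (sharp mu r (EFin \o f) B) = 0 -> (osc_beta mu B beta (T f) <= 0)%E.
Proof.
move=> beta0 beta1 sig0.
have fi := Lfun_EFin_integrable; have gi := centred_integrable filt fi bB.
have s0 : (sharp mu r (EFin \o f) B <= 0%:E)%E.
  by rewrite -(fineK sharp_fin_num) sig0.
have B0 := m_gt0 filt bB.
have z0 : (\int[mu]_(x in B) (`|(EFin \o f) x - c%:E| `^ r) <= 0)%E.
  have := (mean_leP filt r1 (fun x => (EFin \o f) x - c%:E)%E bB (lexx 0)).1 s0.
  by rewrite powR0 ?gt_eqF// mul0r.
have g0 : (\int[mu]_x `|(g x)%:E| = 0)%E.
  apply/eqP; rewrite eq_le integral_ge0// andbT.
  apply/lee_addgt0Pr => e e0; rewrite add0e.
  pose s := e / m setT.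
  have T0 := m_gt0 filt (ball_setT filt).
  have sp : 0 < s by rewrite divr_gt0.
  apply: (@le_trans _ _ ((1 + 0) * s * m setT)%:E).
    apply: (@first_moment_le _ _ _ _ _ r1 (fun x => `|(g x)%:E|%E)) => //.
      apply: measurableT_comp => //; exact: measurable_int gi.
    by rewrite centred_moment !mul0r.
  by rewrite /s addr0 mul1r divfK// gt_eqF.
have ce0 n x : cond_exp mu BB n g x = 0.
  apply/eqP; rewrite -normr_le0; have bA := cell_ball filt n x.
  apply: le_trans (avg_norm filt gi bA) _; rewrite /avg.
  rewrite pmulr_lle0 ?invr_gt0 ?(m_gt0 filt bA)//.
  rewrite fine_le0// -g0; apply: ge0_subset_integral => //.
  - exact: ball_measurable filt _ bA.
  - exact: measurable_int (integrable_absf gi).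
  - by move=> y _; rewrite lee_fin.
have dif0' k x : dif k g x = 0 by rewrite /dif !ce0 subrr.
have Tg0 x : (`|T g x| <= 0)%E.
  apply: (operator_dominated filt opT (lexx 0)).
    by move=> n; rewrite /partial_transform big1 ?normr0// => k _; rewrite dif0' mulr0.
  by rewrite expr0n eseries0// => k _ _; rewrite dif0' expr0n.
apply/lee_addgt0Pr => e e0; rewrite add0e.
have -> : e = 2 * (e / 2) by field.
have e20 : 0 < e / 2 by rewrite divr_gt0.
apply: (osc_beta_le fi bB e20).
rewrite (_ : [set x | _] = set0) ?measure0 ?mulr_gt0 ?subr_gt0//.
apply/seteqP; split=> // x /=; rewrite ltNge => /negP; apply.
by apply: le_trans (Tg0 x) _; rewrite lee_fin ltW.
Qed.

Lemma osc_beta_bound (beta : R) : 0 < beta -> beta < 1 ->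
  (osc_beta mu B beta (T f) <=
   2%:E * (((1 - beta) `^ (- r^-1))%:E * weak_type_norm mu r T
           + osc_norm mu BB r (@inv_log2 R) T)
     * sharp_sup mu BB r (EFin \o f) B)%E.
Proof.
move=> beta0 beta1.
set q := (1 - beta) `^ _; set W := weak_type_norm _ _ _.
set L := osc_norm _ _ _ _ _; set S := sharp_sup _ _ _ _ _.
have q0 : 0 < q by rewrite powR_gt0// subr_gt0.
have W0 : (0 <= W)%E by apply: le_ereal_inf_tmp => _ [K [K0 _] <-].
have L0 : (0 <= L)%E by apply: le_ereal_inf_tmp => _ [K [K0 _] <-].
have SB : (sharp mu r (EFin \o f) B <= S)%E.
  by apply: ereal_sup_ubound; exists B => //; split.
have sB0 : (0 <= sharp mu r (EFin \o f) B)%E by exact: poweR_ge0.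
have S0 : (0 <= S)%E by exact: le_trans SB.
have WL0 : (0 <= q%:E * W + L)%E by rewrite adde_ge0// mule_ge0// lee_fin ltW.
have [s0|s0] := eqVneq (fine (sharp mu r (EFin \o f) B)) 0.
  apply: le_trans (osc_beta_sharp0 beta0 beta1 s0) _.
  by rewrite !mule_ge0.
set sig := fine _ in s0; have sigp : 0 < sig by rewrite lt_neqAle eq_sym s0 fine_ge0.
have sigE : sharp mu r (EFin \o f) B = sig%:E by rewrite /sig fineK// sharp_fin_num.
have [Wy|WNy] := eqVneq W +oo%E.
  rewrite Wy gt0_muley ?lte_fin// addye; last by rewrite gt_eqF// (lt_le_trans _ L0) ?ltNy0.
  by rewrite gt0_muley// gt0_mulye ?leey// (lt_le_trans _ SB)// sigE lte_fin.
have WE : ((fine W)%:E = W)%E by rewrite fineK// ge0_fin_numE// ltey.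
apply: (@le_trans _ _ ((2 * (q * fine W * sig))%:E)).
  apply/lee_addgt0Pr => e e0.
  (* The increase of the bound caused by [K <= fine W + de] and by the margin
     [de] of [osc_beta_weak] adds up to [e]. *)
  pose de := e / (2 * (q * sig + 1)).
  have de0 : 0 < de by rewrite divr_gt0// mulr_gt0// ltr_wpDl// mulr_ge0// ltW.
  have Wfin : W \is a fin_num by rewrite -WE.
  have [_ [K [K0 HK] <-] KW] := lb_ereal_inf_adherent de0 Wfin.
  rewrite -/(weak_type_norm mu r T) -/W in KW.
  rewrite -WE -EFinD lte_fin in KW.
  apply: (le_trans (osc_beta_weak beta0 beta1 K0 de0 HK)).
  rewrite -/sig -/q -EFinD lee_fin.
  have eE : e = 2 * (de * (q * sig + 1)).
    rewrite /de; field; rewrite gt_eqF// ltr_wpDl// mulr_ge0// ltW//.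
  have : q * K * sig <= q * (fine W + de) * sig.
    by rewrite ler_wpM2r ?(ltW sigp)// ler_wpM2l ?(ltW q0)// ltW.
  by rewrite eE; lra.
rewrite mulrA EFinM; apply: lee_pmul; rewrite ?lee_fin ?(ltW sigp)//.
- by rewrite !mulr_ge0 ?fine_ge0 ?(ltW q0).
- rewrite EFinM; apply: lee_wpmul2l => //.
  by rewrite EFinM WE leeDl.
- by rewrite -sigE.
Qed.

End lebesgue_class.

End oscillation.

(** * Boundedness on BMO *)

Lemma share_bounds (R : realType) (u h : R) : 1 <= u -> 1 <= h ->
  [/\ 0 < (16 * u * h)^-1, (16 * u * h)^-1 * h < 1, (16 * u * h)^-1 < 8^-1 &
    u * (2 * (16 * u * h)^-1) <= 2^-1].
Proof.
move=> u1 h1; have u0 : 0 < u by lra.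
have h0 : 0 < h by lra.
have uh : 1 <= u * h by rewrite mulr_ege1.
have p0 : 0 < 16 * u * h by rewrite !mulr_gt0.
split; first by rewrite invr_gt0.
- have -> : (16 * u * h)^-1 * h = (16 * u)^-1 by field; rewrite !gt_eqF.
  by rewrite invf_lt1 ?mulr_gt0//; lra.
- by rewrite ltf_pV2 ?posrE// -mulrA; lra.
- have -> : u * (2 * (16 * u * h)^-1) = (8 * h)^-1 by field; rewrite !gt_eqF.
  by rewrite lef_pV2 ?posrE ?mulr_gt0//; lra.
Qed.

Section bmo.
Context d (X : measurableType d) (R : realType).
Variable mu : {finite_measure set X -> \bar R}.
Variable BB : nat -> set (set X).
Hypothesis filt : filtration mu BB.
Variable eta : R.
Hypothesis eta1 : 1 <= eta.
Hypothesis reg : regular mu BB eta.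
Variable r : R.
Hypothesis r1 : 1 < r.
Local Notation m A := (fine (mu A)).
Local Notation centred := (centred mu).

Let r0 : 0 < r. Proof. exact: lt_trans ltr01 r1. Qed.
Let ep : 0 < 1 + eta. Proof. exact: ltr_wpDr (le_trans ler01 eta1) ltr01. Qed.

(** The share of each ball that may be exceptional; [share_bounds] are the
    smallness conditions of [dist_moment]. *)
Definition share : R := (16 * 2 `^ r * (1 + eta))^-1.

Let two_r : 1 <= (2 : R) `^ r.
Proof.
have two1 : (1 : R) <= 2 by rewrite ler1n.
by have := ler_powR two1 (ltW r0); rewrite powRr0.
Qed.

Let share_spec : [/\ 0 < share, share * (1 + eta) < 1, share < 8^-1 &
  2 `^ r * (2 * share) <= 2^-1].
Proof.
apply: share_bounds => //; exact: (ler_wpDr (le_trans ler01 eta1) (lexx 1)).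
Qed.

Let share_gt0 : 0 < share. Proof. by have [] := share_spec. Qed.
Let share_eta : share * (1 + eta) < 1. Proof. by have [] := share_spec. Qed.
Let share8 : share < 8^-1. Proof. by have [] := share_spec. Qed.
Let share_r : 2 `^ r * (2 * share) <= 2^-1. Proof. by have [] := share_spec. Qed.

(** In units of the norm of [f], the height that [T f] exceeds, after subtraction
    of a constant, on the given share of a ball only. Stopping at the height
    [lam = 4 * s / share] spends half of the share on Doob's inequality, and
    [(1 + eta) * lam / (height * s) = share / 2] leaves the other half to
    Kolmogorov's. *)
Definition height : R := 8 / share ^+ 2 * (1 + eta).

Let height_gt0 : 0 < height.
Proof. by rewrite mulr_gt0// divr_gt0// exprn_gt0. Qed.

Definition moment_const : R := 2 + 4 `^ r.

Let Kp : 0 <= moment_const. Proof. by rewrite addr_ge0// powR_ge0. Qed.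

Variables (eps : set X -> R) (T : (X -> R) -> X -> \bar R).
Hypothesis eps1 : forall A, balls BB A -> `|eps A| <= 1.
Hypothesis opT : martingale_operator mu BB eps T.

Section function.
Variables (f : X -> R) (s : R).
Hypothesis fi : mu.-integrable setT (EFin \o f).
Hypothesis s0 : 0 < s.
Hypothesis fs : (bmo_norm mu BB r (EFin \o f) <= s%:E)%E.

Lemma centred_first_moment B : balls BB B ->
  \int[mu]_x `|centred f B x| <= 2 * s * m B.
Proof.
move=> bB; have mB := ball_measurable filt bB.
set c := avg mu (EFin \o f) B.
have sB : (sharp mu r (EFin \o f) B <= s%:E)%E.
  by apply: le_trans fs; apply: ereal_sup_ubound; exists B.
have mh : measurable_fun B (fun x => `|(EFin \o f) x - c%:E|)%E.
  apply: measurableT_comp => //; exact: measurable_int (sub_cst_integrable filt B fi mB).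
have := (mean_leP filt r1 (fun x => (EFin \o f) x - c%:E)%E bB (ltW s0)).1 sB.
rewrite -[X in (_ <= X)%E -> _](_ : (1 * s `^ r * m B)%:E = _)%E; last by rewrite mul1r.
move=> /(first_moment_le r1 mB mh _ s0 ler01) H.
rewrite -lee_fin fineK; last first.
  apply: integrable_fin_num => //; exact: (integrable_absf (centred_integrable filt fi bB)).
have -> : (\int[mu]_x (`|centred f B x|)%:E =
    \int[mu]_(x in B) `|(EFin \o f) x - c%:E|)%E.
  rewrite [RHS]integral_mkcond; apply: eq_integral => x _.
  rewrite patchE /centred indicE; case: (x \in B); first by rewrite mulr1.
  by rewrite mulr0 normr0.
exact: H.
Qed.

(** The weak type estimate for [f] recentred on [B], the first moment of which is
    at most [2 * s * m B]. *)
Lemma operator_local B : balls BB B -> exists C : R,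
  m (far (T f) (fun=> C) (height * s) B `&` B) <= share * m B.
Proof.
move=> bB; have mB := ball_measurable filt bB.
have gi := centred_integrable filt fi bB.
have [C [N nN HN]] := operator_split filt eta1 reg eps1 opT fi bB.
have [N' [mN' N'0 NN']] := negligible_cover nN.
pose lam := 4 * s / share.
have lam0 : 0 < lam by rewrite divr_gt0// mulr_gt0.
have t0 : 0 < height * s by rewrite mulr_gt0.
have [E [mE HE off]] := weak_estimate filt eta1 reg eps1 gi mB
  (fun x k => dif_centred_out filt fi bB k (x := x)) lam0 t0.
exists C; apply: (@le_trans _ _ (m (E `|` N'))).
  apply: m_le.
  - apply: measurableI => //; apply: (far_measurable (fun=> C) _ _).
    exact: (operator_measurable filt f opT).
  - exact: measurableU.
  - move=> x [fx Bx]; apply: contrapT => nEN.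
    have [H1 H2] := off x (fun Ex => nEN (or_introl Ex)).
    have := operator_dominated filt opT (ltW t0) H1 H2.
    have := HN x Bx (fun Nx => nEN (or_intror (NN' _ Nx))).
    move=> /le_trans H /H; rewrite leNgt; move: fx; rewrite /far/= /dist.
    by move=> ->.
apply: (le_trans (m_setU _ mE mN')); rewrite N'0 addr0; apply: (le_trans HE).
have B0 := m_gt0 filt bB.
have h1 : \int[mu]_x `|centred f B x| / lam <= share / 2 * m B.
  rewrite ler_pdivrMr//; apply: (le_trans (centred_first_moment bB)).
  by rewrite le_eqVlt; apply/orP; left; apply/eqP; rewrite /lam; field; rewrite gt_eqF.
have -> : (1 + eta) * lam / (height * s) = share / 2.
  by rewrite /lam /height; field; rewrite !gt_eqF.
have h2 : 2 * ((share / 2) ^+ 2 * m B) <= share / 2 * m B.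
  have -> : 2 * ((share / 2) ^+ 2 * m B) = share * (share / 2 * m B) by field.
  by rewrite ler_piMl ?mulr_ge0 ?divr_ge0 ?(ltW share_gt0) ?(ltW B0)//; have := share8; lra.
by lra.
Qed.

Lemma operator_moments : exists c : set X -> R, forall B, balls BB B ->
  (\int[mu]_(x in B) (`|T f x - (c B)%:E| `^ r) <=
   (moment_const * (height * s) `^ r * m B)%:E)%E.
Proof.
have H B : exists C : R, balls BB B ->
    m (far (T f) (fun=> C) (height * s) B `&` B) <= share * m B.
  have [bB|nB] := pselect (balls BB B); last by exists 0.
  by have [C HC] := operator_local bB; exists C.
have [c Hc] := choice H.
have Hc' B : balls BB B -> m (far (T f) c (height * s) B `&` B) <= share * m B.
  exact: Hc.
exists c => B bB; have t0 : 0 < height * s by exact: mulr_gt0.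
exact: (dist_moment filt reg (operator_measurable filt f opT) (ltW r1) t0
  share_gt0 share_eta share8 share_r Hc' bB).
Qed.

Definition bmo_const : R :=
  (2 `^ r * (moment_const + (1 + moment_const) `^ r)) `^ r^-1 * height.

(** Replacing the constant [c B] by the average of [T f] costs a first moment. *)
Lemma operator_bmo : mu.-integrable setT (T f) /\
  (bmo_norm mu BB r (T f) <= (bmo_const * s)%:E)%E.
Proof.
have [c Hc] := operator_moments.
have mT := operator_measurable filt f opT.
have t0 : 0 < height * s by rewrite mulr_gt0.
set t := height * s in t0 Hc.
have md A a : measurable_fun A (fun x => `|T f x - a%:E|)%E.
  apply: measurableT_comp => //; apply: measurable_funTS.
  exact: emeasurable_funB.
have first B : balls BB B ->
    (\int[mu]_(x in B) `|T f x - (c B)%:E| <= ((1 + moment_const) * t * m B)%:E)%E.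
  move=> bB; have mB := ball_measurable filt bB.
  by apply: (first_moment_le r1 mB (md _ _) _ t0 Kp) => //; exact: Hc.
have Ti : mu.-integrable setT (T f).
  apply/integrableP; split=> //.
  have bT := ball_setT filt.
  apply: (@le_lt_trans _ _ (\int[mu]_x (`|T f x - (c setT)%:E| + `|c setT|%:E))%E).
    apply: ge0_le_integral => //.
    - exact: measurableT_comp.
    - exact: emeasurable_funD.
    - move=> x _; case: (T f x) => [y||]//.
      rewrite -EFinB !abse_EFin -EFinD lee_fin.
      by rewrite -[X in `|X| <= _](subrK (c setT)) ler_normD.
  rewrite ge0_integralD// integral_const// lte_add_pinfty ?ltry//.
  exact: le_lt_trans (first _ bT) (ltry _).
split=> //.
apply/ereal_supP => _ [B bB <-].
have mB := ball_measurable filt bB; have B0 := m_gt0 filt bB.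
have TiB : mu.-integrable B (T f) by exact: integrableS Ti.
have ci (a : R) : mu.-integrable B (EFin \o cst a).
  apply: integrableS (bounded_level_integrable filt (bounded_level_cst BB 0 a)) => //.
have close : `|c B - avg mu (T f) B| <= (1 + moment_const) * t.
  rewrite -(ler_pM2r B0) -[X in _ * X]ger0_norm ?(ltW B0)// -normrM mulrBl.
  rewrite -lee_fin /avg divfK ?gt_eqF// distrC.
  have -> : `|fine (\int[mu]_(x in B) T f x)%E - c B * m B|%:E =
      `|\int[mu]_(x in B) (T f x - (c B)%:E)|%E.
    rewrite (integralB mB TiB (ci (c B))) /= integral_const//.
    by rewrite -[in RHS](fineK (integrable_fin_num mB TiB)).
  apply: le_trans (first B bB); apply: le_abse_integral => //.
  by apply: measurable_funTS; exact: emeasurable_funB.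
rewrite /sharp; apply/(mean_leP filt r1 _ bB) => //.
  by rewrite mulr_ge0 ?(ltW s0)// mulr_ge0 ?powR_ge0 ?ltW.
set k1 := (1 + moment_const) * t in close.
have k10 : 0 <= k1 by rewrite mulr_ge0 ?(ltW t0)// addr_ge0.
apply: (@le_trans _ _ (\int[mu]_(x in B) ((2 `^ r)%:E *
    (`|T f x - (c B)%:E| `^ r + (k1 `^ r)%:E)))%E).
  apply: ge0_le_integral => //.
  - by move=> x _; exact: poweR_ge0.
  - exact: (measurableT_comp (measurable_poweR _)).
  - apply: emeasurable_funM => //; apply: emeasurable_funD => //.
    exact: (measurableT_comp (measurable_poweR _)).
  - move=> x _; apply: le_trans (poweRD_le r1 _ k10) => //.
    apply: (le_poweR (ltW r0)) => //.
    case: (T f x) => [y||]//.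
    rewrite -!EFinB !abse_EFin -EFinD lee_fin.
    have -> : y - avg mu (T f) B = (y - c B) + (c B - avg mu (T f) B) by lra.
    by rewrite (le_trans (ler_normD _ _))// lerD2l.
have mr : measurable_fun B (fun x => `|T f x - (c B)%:E| `^ r)%E.
  exact: (measurableT_comp (measurable_poweR _)).
rewrite ge0_integralZl_EFin ?powR_ge0//; last 2 first.
- by move=> x _; rewrite adde_ge0 ?poweR_ge0// lee_fin powR_ge0.
- exact: emeasurable_funD.
rewrite ge0_integralD//; last 2 first.
- by move=> x _; exact: poweR_ge0.
- by move=> x _; rewrite lee_fin powR_ge0.
rewrite integral_const//.
have -> : ((bmo_const * s) `^ r * m B)%:E =
    ((2 `^ r)%:E * ((moment_const * t `^ r * m B)%:E + (k1 `^ r * m B)%:E))%E.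
  rewrite -EFinD -EFinM; congr (_%:E).
  rewrite /bmo_const -mulrA -/t powRM ?powR_ge0 ?(ltW t0)// -powRrM mulVf ?gt_eqF//.
  rewrite powRr1 ?mulr_ge0 ?addr_ge0 ?powR_ge0//.
  rewrite /k1 powRM ?addr_ge0 ?(ltW t0)//; ring.
apply: lee_wpmul2l; first by rewrite lee_fin powR_ge0.
by rewrite leeD2r//; exact: Hc.
Qed.

End function.

Lemma bmo_norm_ge0 F : (0 <= bmo_norm mu BB r F)%E.
Proof.
apply: le_ereal_sup_tmp; exists (sharp mu r F setT); last exact: poweR_ge0.
by exists setT => //; exact: ball_setT filt.
Qed.

Lemma operator_in_bmo f : in_bmo mu BB r (EFin \o f) ->
  in_bmo mu BB r (T f) /\
  (bmo_norm mu BB r (T f) <= bmo_const%:E * bmo_norm mu BB r (EFin \o f))%E.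
Proof.
move=> [fi fin]; set b := bmo_norm _ _ _ (EFin \o f) in fin *.
have b0 : (0 <= b)%E := bmo_norm_ge0 _.
have bE : (fine b)%:E = b by rewrite fineK// ge0_fin_numE.
have C0 : 0 <= bmo_const by rewrite mulr_ge0 ?powR_ge0// ltW.
have H e : 0 < e -> mu.-integrable setT (T f) /\
    (bmo_norm mu BB r (T f) <= (bmo_const * (fine b + e))%:E)%E.
  move=> e0; apply: operator_bmo => //; first by rewrite ltr_wpDl// fine_ge0.
  by rewrite EFinD bE leeDl// lee_fin ltW.
split.
  split; first by have [] := H 1 ltr01.
  by have [_ /le_lt_trans] := H 1 ltr01; apply; exact: ltry.
apply/lee_addgt0Pr => e e0.
have C1 : 0 < bmo_const + 1 by rewrite ltr_wpDl.
have [_ H'] := H (e / (bmo_const + 1)) (divr_gt0 e0 C1).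
apply: (le_trans H'); rewrite -bE -EFinM -EFinD lee_fin mulrDr lerD2l.
rewrite mulrA ler_pdivrMr// mulrC ler_pM2l//; lra.
Qed.

End bmo.

Unset Implicit Arguments.

Theorem mainTheorem8 (d : measure_display) (X : measurableType d)
    (R : realType) (mu : {finite_measure set X -> \bar R})
    (BB : nat -> set (set X)) (r : R) :
  filtration mu BB -> doubling mu BB -> 1 < r ->
  exists2 C : R, 0 < C &
    forall (eps : set X -> R) (T : (X -> R) -> X -> \bar R),
      (forall A, balls BB A -> `|eps A| <= 1) ->
      martingale_operator mu BB eps T ->
      (forall (f : X -> R) (B : set X) (beta : R),
         f \in Lfun mu r%:E -> balls BB B -> 0 < beta -> beta < 1 ->
         (osc_beta mu B beta (T f) <=
          C%:E * (((1 - beta) `^ (- r^-1))%:E * weak_type_norm mu r T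
                  + osc_norm mu BB r (@inv_log2 R) T)
            * sharp_sup mu BB r (EFin \o f) B)%E) /\
      (exists C' : R, forall f : X -> R, in_bmo mu BB r (EFin \o f) ->
         in_bmo mu BB r (T f) /\
         (bmo_norm mu BB r (T f)
            <= C'%:E * bmo_norm mu BB r (EFin \o f))%E).
Proof.
move=> filt /(doubling_regular filt)[eta eta1 reg] r1.
exists 2 => // eps T eps1 opT; split.
  move=> f B beta fr bB beta0 beta1.
  exact: (osc_beta_bound filt eta1 reg r1 eps1 opT fr bB beta0 beta1).
exists (bmo_const eta r) => f; exact: (operator_in_bmo filt eta1 reg r1 eps1 opT).
Qed.
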